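(* Let $B_1\subset\mathbb{R}^2$ be the open unit disc and let $K\in L^\infty(B_1)$ be nonnegative. Let $u\in C^2(B_1\setminus\{0\})$ be a solution of \[ -\Delta u = K(x)e^{u}\quad\text{in } B_1\setminus\{0\} \] satisfying \[ \int_{B_1\setminus\{0\}} e^{u(x)}\,dx<+\infty . \] Then there exist a constant $\alpha>-2$, a radius $\rho\in(0,1)$, an exponent $\gamma\in(0,1)$ and a function $\varphi\in C^{\gamma}(B_\rho)$ (Hölder continuous on $B_\rho$) such that \[ u(x)=\alpha\ln|x|+\varphi(x)\quad\text{for all } x\in B_\rho\setminus\{0\}. \]
   Context: $B_r$ denotes the open ball of radius $r$ centered at the origin. The equation holds pointwise in $B_1\setminus\{0\}$. *)

(* Defs.v *)
From HB Require Import structures.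
From mathcomp Require Import all_boot all_order all_algebra.
From mathcomp Require Import all_classical all_reals all_analysis.
Set Implicit Arguments. Unset Strict Implicit. Unset Printing Implicit Defensive.
Import Order.TTheory GRing.Theory Num.Theory.
Import numFieldNormedType.Exports.
Local Open Scope classical_set_scope.
Local Open Scope ring_scope.

Section Defs.
Variable R : realType.

Definition enorm (x : R * R) : R := Num.sqrt (x.1 ^+ 2 + x.2 ^+ 2).

Definition disc (r : R) : set (R * R) := [set x | enorm x < r].
Definition pdisc (r : R) : set (R * R) := [set x | 0 < enorm x < r].

Definition e1 : R * R := (1, 0).
Definition e2 : R * R := (0, 1).

Definition pd (f : R * R -> R) (v : R * R) : R * R -> R := fun x => 'D_v f x.

Definition C2_on (U : set (R * R)) (f : R * R -> R) : Prop :=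
  forall x, U x ->
    {for x, continuous f} /\
    forall v, v = e1 \/ v = e2 ->
      derivable f x v /\ {for x, continuous (pd f v)} /\
      forall w, w = e1 \/ w = e2 ->
        derivable (pd f v) x w /\ {for x, continuous (pd (pd f v) w)}.

Definition laplacian (f : R * R -> R) (x : R * R) : R :=
  pd (pd f e1) e1 x + pd (pd f e2) e2 x.

Definition hoelder_on (g : R) (A : set (R * R)) (phi : R * R -> R) : Prop :=
  exists C : R, forall x y, A x -> A y ->
    `|phi x - phi y| <= C * powR (enorm (x - y)) g.

Definition leb2 := ((@lebesgue_measure R) \x (@lebesgue_measure R))%E.

End Defs.

(* Main.v *)
Require Import Defs.
From HB Require Import structures.
From mathcomp Require Import all_boot all_order all_algebra.
From mathcomp Require Import all_classical all_reals all_analysis.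
From mathcomp Require Import measurable_realfun ring lra.
Import Order.TTheory GRing.Theory Num.Theory.
Import numFieldNormedType.Exports.
Local Open Scope classical_set_scope.
Local Open Scope ring_scope.
Set Implicit Arguments.
Unset Strict Implicit.
Unset Printing Implicit Defensive.

(* Since [K = - (laplacian u) exp (- u)] is continuous on the punctured disc,
   [0 <= K <= M] holds there pointwise. Green's identity against a smeared
   logarithm, on squares, gives mean value inequalities with explicit errors,
   hence a Harnack inequality and, by the Choi-Schoen point-picking trick,
   [|x|^2 exp (u x) -> 0] at the origin.

   With [t = ln |x|], the comparison principle makes the minimum of [u] on
   circles concave in [t]; as [u + 2 t] tends to [-oo], it is below [c + d t]
   for some [d > 0], first for the minimum and then, by Harnack, for [u].
   Thus [- laplacian u <= C |x|^(d - 2)], and the maximum of [u + B |x|^d] on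
   circles is convex in [t]. Applying Harnack to the difference between the
   latter function and its chords shows that the gap [D] between the convex
   maximum and the concave minimum satisfies
   [D t <= C ((D (t - 1) + D (t + 1)) / 2 - D t) + C exp (d t)]; having at most
   linear growth, [D] decays like [exp (g t)]. An affine function
   [alpha t + beta] separates the concave function from the convex one, so
   [u - alpha ln |x| - beta = O(|x|^g)], with [alpha > -2]. Comparing weighted
   means of [u] around two neighbouring points upgrades this to Hoelder
   continuity. *)

(** * Integration on squares *)

Section squares.
Context {R : realType}.
Implicit Types (x y z : R * R) (r s t : R).

(** Squares are used because on them Green's identity is only Fubini and the one-dimensional
    fundamental theorem, and a test function vanishing to first order on the sides leaves no
    boundary integral. Smearing the logarithm keeps the test function regular at its pole; its
    Laplacian is a bounded bump, which shrinks to a point in the limit.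

    The sign of the equation makes only the minimum of [u] on circles concave. Convexity of the
    maximum has to be bought with [B |x|^d], which needs a bound on [exp u] better than [|x|^-2].
    The gain [d > 0] comes from convexity: a convex function of [t] tending to [+oo] at [-oo] does
    so at least linearly.

    The inequality for [D] is a discrete analogue of [D <= C D''], whose solutions grow or decay
    exponentially; the linear bound excludes growth.

    The Laplacian is controlled only by [|x|^(g - 2)], so Hoelder continuity compares means at the
    scale [sqrt(|x| h)], between the distance [h] of the two points and their distance to the
    origin. This loses a square root, whence an exponent at most [1 / 2]. *)

Definition sq x r : set (R * R) :=
  [set z | `|z.1 - x.1| <= r /\ `|z.2 - x.2| <= r].

(** Continuity at the points of [A] is taken in the whole plane, not relative to [A]; so it passes
    to subsets and to slices without any openness of [A]. *)
Definition continuous_on (A : set (R * R)) (f : R * R -> R) :=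
  forall z, A z -> {for z, continuous f}.

Local Notation mu := (@lebesgue_measure R).
Local Notation mu2 := (mu \x mu)%E.

Lemma sqE x r :
  sq x r = `[x.1 - r, x.1 + r]%classic `*` `[x.2 - r, x.2 + r]%classic.
Proof.
by apply/seteqP; split => z; rewrite /sq /setX/= !in_itv/= !ler_distl.
Qed.

Lemma measurable_sq x r :
  measurable (sq x r : set (measurableTypeR R * measurableTypeR R)).
Proof. by rewrite sqE; apply: measurableX; exact: measurable_itv. Qed.

Lemma compact_sq x r : compact (sq x r).
Proof. by rewrite sqE; apply: compact_setX; exact: segment_compact. Qed.

Lemma measure_sq x r : 0 <= r -> mu2 (sq x r) = ((2 * r) ^+ 2)%:E.
Proof.
move=> r0; rewrite sqE product_measure1E//.
have h (a : R) : mu `[a - r, a + r]%classic = (2 * r)%:E.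
  rewrite lebesgue_measure_itv/= lte_fin.
  case: ifPn => [r1|]; first by rewrite -EFinB; congr EFin; ring.
  by rewrite -leNgt => r1; congr EFin; lra.
rewrite [X in (X * _)%E]h [X in (_ * X)%E]h -EFinM; congr EFin; ring.
Qed.

Lemma ball_prod x e z : ball x e z <-> `|x.1 - z.1| < e /\ `|x.2 - z.2| < e.
Proof. by []. Qed.

Lemma near_sq z (P : set (R * R)) : nbhs z P ->
  exists2 e, 0 < e & sq z e `<=` P.
Proof.
move=> /nbhs_ballP[e/= e0 eP]; exists (e / 2); first by rewrite divr_gt0.
move=> w [w1 w2]; apply: eP; apply/ball_prod.
by split; rewrite distrC; lra.
Qed.

(** Second countability: a superlevel set is the trace on [A] of countably many open squares with
    rational centre and half-side, each of them in the product sigma-algebra. *)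
Lemma continuous_on_measurable (A : set (R * R)) (f : R * R -> R) :
  measurable (A : set (measurableTypeR R * measurableTypeR R)) ->
  continuous_on A f ->
  measurable_fun (A : set (measurableTypeR R * measurableTypeR R)) f.
Proof.
move=> mA cf; apply: (measurability _ (RGenOInfty.measurableE R)).
move=> /= _ [_ [a ->]] <-.
pose B (i : rat * rat * rat) : set (R * R) :=
  `](ratr i.1.1 - ratr i.2)%R, (ratr i.1.1 + ratr i.2)%R[%classic `*`
  `](ratr i.1.2 - ratr i.2)%R, (ratr i.1.2 + ratr i.2)%R[%classic.
pose F i := [set z | B i z /\ B i `<=` f @^-1` `]a, +oo[%classic].
have -> : A `&` f @^-1` `]a, +oo[%classic = A `&` \bigcup_i F i.
  apply/seteqP; split => z [Az].
    move=> fz; split => //.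
    have : \forall w \near z, a < f w.
      by apply: (cvgr_gt (f z) (cf z Az)); move: fz; rewrite /= in_itv/= andbT.
    move=> /near_sq[e e0 he].
    (* Centre within [e / 4] of [z] and half-side between [e / 4] and [e / 2]: the rational square
       contains [z] and stays inside [sq z e]. *)
    have e2 : 0 < e / 4 by rewrite divr_gt0.
    have [q3] := @rat_in_itvoo R (e / 4) (e / 2) ltac:(lra).
    rewrite in_itv/= => /andP[q31 q32].
    have [q1] := @rat_in_itvoo R (z.1 - e / 4) (z.1 + e / 4) ltac:(lra).
    rewrite in_itv/= => /andP[q11 q12].
    have [q2] := @rat_in_itvoo R (z.2 - e / 4) (z.2 + e / 4) ltac:(lra).
    rewrite in_itv/= => /andP[q21 q22].
    have hB : B (q1, q2, q3) `<=` f @^-1` `]a, +oo[%classic.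
      move=> w; rewrite /B/= !in_itv/= => -[/andP[w1 w2] /andP[w3 w4]].
      by rewrite andbT; apply: he; rewrite /sq/= !ler_distl; lra.
    exists (q1, q2, q3) => //; split => //.
    by rewrite /B/= !in_itv/=; lra.
  by move=> [i _ [Bz h]]; split => //; exact: h.
apply: measurableI => //; apply: countable_bigcupT_measurable => //.
move=> i; have [h|h] := pselect (B i `<=` f @^-1` `]a, +oo[%classic); last first.
  by rewrite (_ : F i = set0)//; apply/seteqP; split => // z [].
rewrite (_ : F i = B i); first by apply: measurableX; exact: measurable_itv.
by apply/seteqP; split => // z [].
Qed.

Lemma continuous_on_bounded (A : set (R * R)) (f : R * R -> R) :
  compact A -> continuous_on A f -> exists M, forall z, A z -> `|f z| <= M.
Proof.
move=> cA cf.
have cf' : {within A, continuous f}.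
  by apply: continuous_in_subspaceT => z /set_mem; exact: cf.
have /compact_bounded[M [_ mrt]] := continuous_compact cf' cA.
exists (M + 1) => z Az; apply: (mrt (M + 1)); first lra.
by exists z.
Qed.

Lemma continuous_on_integrable x r (f : R * R -> R) :
  continuous_on (sq x r) f -> mu2.-integrable (sq x r) (EFin \o f).
Proof.
move=> cf; apply: measurable_bounded_integrable.
- exact: measurable_sq.
- have [r0|r0] := leP 0 r; first by rewrite [X in (X < _)%E](measure_sq x r0) ltry.
  rewrite (_ : sq x r = set0) ?measure0//; apply/seteqP; split => // z [+ _].
  move=> h; have := normr_ge0 (z.1 - x.1); lra.
- by apply: continuous_on_measurable => //; exact: measurable_sq.
- have [M hM] := continuous_on_bounded (@compact_sq x r) cf.
  exists M; split; rewrite ?num_real// => N MN z /hM h /=.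
  exact: le_trans h (ltW MN).
Qed.

End squares.

(** * Integrals of partial derivatives over a square *)

Section slices.
Context {R : realType}.
Implicit Types (x y z : R * R) (r s t : R).
Local Notation mu := (@lebesgue_measure R).
Local Notation mu2 := (mu \x mu)%E.

Lemma slice1_continuous (f : R * R -> R) a b :
  {for (a, b), continuous f} -> {for a, continuous (fun h => f (h, b))}.
Proof.
move=> cf; apply: (@cvg_comp _ _ _ (fun h : R => (h, b)) f (nbhs a) _ _ _ cf).
by apply: (@cvg_pair _ _ _ (nbhs a) (nbhs a) (nbhs b)); [exact: cvg_id|exact: cvg_cst].
Qed.

Lemma slice2_continuous (f : R * R -> R) a b :
  {for (a, b), continuous f} -> {for b, continuous (fun h => f (a, h))}.
Proof.
move=> cf; apply: (@cvg_comp _ _ _ (fun h : R => (a, h)) f (nbhs b) _ _ _ cf).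
by apply: (@cvg_pair _ _ _ (nbhs b) (nbhs a) (nbhs b)); [exact: cvg_cst|exact: cvg_id].
Qed.

Lemma FTC_closed (F G : R -> R) a b : a < b ->
  (forall s, a <= s <= b -> {for s, continuous F}) ->
  (forall s, a <= s <= b -> is_derive s 1 G (F s)) ->
  (\int[mu]_(s in `[a, b]) (F s)%:E = (G b)%:E - (G a)%:E)%E.
Proof.
move=> ab cF dG.
have cG s : a <= s <= b -> {for s, continuous G}.
  move=> /dG h; apply: differentiable_continuous; apply/derivable1_diffP.
  exact: (@ex_derive _ _ _ _ _ _ _ h).
apply: continuous_FTC2 => //.
- apply: continuous_in_subspaceT => s /set_mem /=; rewrite in_itv/=; exact: cF.
- split.
  + move=> s; rewrite in_itv/= => /andP[s1 s2].
    by have /dG h : a <= s <= b by rewrite !ltW.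
  + by apply: cvg_at_right_filter; apply: cG; rewrite lexx ltW.
  + by apply: cvg_at_left_filter; apply: cG; rewrite lexx ltW.
- move=> s; rewrite in_itv/= => /andP[s1 s2].
  have /dG h : a <= s <= b by rewrite !ltW.
  by rewrite derive1E; exact: derive_val.
Qed.

(** Fubini on the plane, after extending the integrand by zero off the square, leaves [F] on each
    horizontal segment, where [G] is a primitive with equal end values. *)
Lemma sq_integral_d1_eq0 x r (F G : R * R -> R) : 0 < r ->
  continuous_on (sq x r) F ->
  (forall z, sq x r z -> is_derive z.1 1 (fun h => G (h, z.2)) (F z)) ->
  (forall b, `|b - x.2| <= r -> G (x.1 - r, b) = G (x.1 + r, b)) ->
  \int[mu2]_(z in sq x r) F z = 0.
Proof.
move=> r0 cF dG G0; rewrite /Rintegral integral_mkcond.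
rewrite -(@integral21_prod_meas1 _ _ _ _ _ mu mu); last first.
  have I := continuous_on_integrable cF.
  exact/(integrable_mkcond _ (measurable_sq x r)).
rewrite integral0_eq// => b _; rewrite /fubini_G.
have [hb|hb] := boolP (`|b - x.2| <= r); last first.
  apply: integral0_eq => a _; rewrite patchE; case: ifPn => // /set_mem[_ /= h].
  by rewrite h in hb.
transitivity (\int[mu]_(s in `[(x.1 - r)%R, (x.1 + r)%R]%classic) (F (s, b))%:E)%E.
  rewrite [RHS]integral_mkcond; apply: eq_integral => a _.
  rewrite !patchE; congr (if _ then _ else _).
  apply/idP/idP => /set_mem h; apply/mem_set.
    by case: h => /=; rewrite in_itv/= ler_distl.
  by split => //=; move: h; rewrite /= in_itv/= ler_distl.
have rr : x.1 - r < x.1 + r by lra.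
have cF' s : x.1 - r <= s <= x.1 + r -> {for s, continuous (fun s => F (s, b))}.
  move=> hs; apply: slice1_continuous; apply: cF; split => //=.
  by rewrite ler_distl.
have dG' s : x.1 - r <= s <= x.1 + r ->
    is_derive s 1 (fun s => G (s, b)) (F (s, b)).
  by move=> hs; apply: (dG (s, b)); split => //=; rewrite ler_distl.
by rewrite (FTC_closed rr cF' dG') G0// subee.
Qed.

Lemma sq_integral_d2_eq0 x r (F G : R * R -> R) : 0 < r ->
  continuous_on (sq x r) F ->
  (forall z, sq x r z -> is_derive z.2 1 (fun h => G (z.1, h)) (F z)) ->
  (forall a, `|a - x.1| <= r -> G (a, x.2 - r) = G (a, x.2 + r)) ->
  \int[mu2]_(z in sq x r) F z = 0.
Proof.
move=> r0 cF dG G0; rewrite /Rintegral integral_mkcond.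
rewrite -(@integral12_prod_meas1 _ _ _ _ _ mu mu); last first.
  have I := continuous_on_integrable cF.
  exact/(integrable_mkcond _ (measurable_sq x r)).
rewrite integral0_eq// => a _; rewrite /fubini_F.
have [ha|ha] := boolP (`|a - x.1| <= r); last first.
  apply: integral0_eq => b _; rewrite patchE; case: ifPn => // /set_mem[/= h _].
  by rewrite h in ha.
transitivity (\int[mu]_(s in `[(x.2 - r)%R, (x.2 + r)%R]%classic) (F (a, s))%:E)%E.
  rewrite [RHS]integral_mkcond; apply: eq_integral => b _.
  rewrite !patchE; congr (if _ then _ else _).
  apply/idP/idP => /set_mem h; apply/mem_set.
    by case: h => _ /=; rewrite in_itv/= ler_distl.
  by split => //=; move: h; rewrite /= in_itv/= ler_distl.
have rr : x.2 - r < x.2 + r by lra.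
have cF' s : x.2 - r <= s <= x.2 + r -> {for s, continuous (fun s => F (a, s))}.
  move=> hs; apply: slice2_continuous; apply: cF; split => //=.
  by rewrite ler_distl.
have dG' s : x.2 - r <= s <= x.2 + r ->
    is_derive s 1 (fun s => G (a, s)) (F (a, s)).
  by move=> hs; apply: (dG (a, s)); split => //=; rewrite ler_distl.
by rewrite (FTC_closed rr cF' dG') G0// subee.
Qed.

End slices.

(** * The smeared fundamental solution *)

Section kernel.
Context {R : realType}.
Implicit Types (s t a b : R) (f g : R -> R).

(** Writing differentiability as an increment estimate removes the quotient, so that two branches
    can be treated together at the point where they are glued. *)
Lemma is_derive_eps f s D : is_derive s 1 f D <->
  forall e, 0 < e -> exists2 d, 0 < d &
    forall h, `|h| < d -> `|f (s + h) - f s - D * h| <= e * `|h|.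
Proof.
split.
  move=> df e e0; have [df1 df2] := df.
  have : (fun h => h^-1 *: ((f \o shift s) (h *: 1) - f s)) @ 0^' --> D.
    by rewrite -df2; exact: df1.
  move=> /cvgrPdist_le/(_ _ e0); rewrite near_withinE => /nbhs_ballP[d/= d0 hd].
  exists d => // h hh; have [->|h0] := eqVneq h 0.
    by rewrite addr0 mulr0 subr0 subrr normr0 mulr0.
  have /hd : ball 0 d h by rewrite /ball/= sub0r normrN.
  move=> /(_ h0); rewrite /= -[_ *: (1 : R)]/(h * 1) mulr1 -[_ *: _]/(h^-1 * _).
  rewrite [h + s]addrC distrC => hD.
  have -> : f (s + h) - f s - D * h = (h^-1 * (f (s + h) - f s) - D) * h.
    by field.
  by rewrite normrM ler_wpM2r.
move=> H.
have cv : (fun h => h^-1 *: ((f \o shift s) (h *: 1) - f s)) @ 0^' --> D.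
  apply/cvgrPdist_le => e e0; have [d d0 hd] := H _ e0.
  rewrite near_withinE; apply/nbhs_ballP; exists d => //= h.
  rewrite /ball/= sub0r normrN => /hd hh h0.
  rewrite /= -[_ *: (1 : R)]/(h * 1) mulr1 -[_ *: _]/(h^-1 * _).
  rewrite [h + s]addrC distrC.
  have -> : h^-1 * (f (s + h) - f s) - D = (f (s + h) - f s - D * h) / h.
    by field.
  by rewrite normrM normfV ler_pdivrMr ?normr_gt0.
by split; [exact: cvgP cv|exact: cvg_lim cv].
Qed.

Lemma is_derive_continuous f s D : is_derive s 1 f D -> {for s, continuous f}.
Proof.
move=> h; apply: differentiable_continuous; apply/derivable1_diffP.
exact: (@ex_derive _ _ _ _ _ _ _ h).
Qed.

Lemma is_deriveDE f g s a b : is_derive s 1 f a -> is_derive s 1 g b ->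
  is_derive s 1 (fun h => f h + g h) (a + b).
Proof. exact: is_deriveD. Qed.

Lemma is_deriveBE f g s a b : is_derive s 1 f a -> is_derive s 1 g b ->
  is_derive s 1 (fun h => f h - g h) (a - b).
Proof. exact: is_deriveB. Qed.

Lemma is_deriveME f g s a b : is_derive s 1 f a -> is_derive s 1 g b ->
  is_derive s 1 (fun h => f h * g h) (a * g s + f s * b).
Proof.
by move=> fa gb; apply: is_derive_eq (is_deriveM fa gb) _; rewrite addrC mulrC.
Qed.

Lemma is_deriveZE (k : R) f s a : is_derive s 1 f a ->
  is_derive s 1 (fun h => k * f h) (k * a).
Proof. exact: is_deriveZ. Qed.

Lemma is_derive_cstE (k s : R) : is_derive s 1 (fun _ => k) (0 : R).
Proof. exact: is_derive_cst. Qed.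

Lemma is_derive_idE (s : R) : is_derive s 1 (fun h : R => h) (1 : R).
Proof. exact: is_derive_id. Qed.

Lemma is_derive_compE f g s a b : is_derive (g s) 1 f a -> is_derive s 1 g b ->
  is_derive s 1 (fun h => f (g h)) (a * b).
Proof. exact: is_derive1_comp. Qed.

(** At [s = a] every increment falls under one of the two expansions, and these share value and
    slope there. *)
Lemma is_derive_glue f g df dg a :
  (forall s, s <= a -> is_derive s 1 f (df s)) ->
  (forall s, a <= s -> is_derive s 1 g (dg s)) ->
  f a = g a -> df a = dg a ->
  forall s, is_derive s 1 (fun t => if t <= a then f t else g t)
                      (if s <= a then df s else dg s).
Proof.
move=> fd gd fga dfga s; apply/is_derive_eps => e e0.
case: (ltgtP s a) => sa.
- have /is_derive_eps/(_ _ e0)[d d0 hd] := fd s (ltW sa).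
  exists (Num.min d (a - s)); first by rewrite lt_min d0; lra.
  move=> h; rewrite lt_min => /andP[/hd + ha]; rewrite ifT//.
  by have := ler_norm h; lra.
- have /is_derive_eps/(_ _ e0)[d d0 hd] := gd s (ltW sa).
  exists (Num.min d (s - a)); first by rewrite lt_min d0; lra.
  move=> h; rewrite lt_min => /andP[/hd + ha]; rewrite ifF//.
  have := ler_norm (- h); rewrite normrN => hh; apply/negbTE; rewrite -ltNge; lra.
- have /is_derive_eps/(_ _ e0)[d d0 hd] := fd s ltac:(lra).
  have /is_derive_eps/(_ _ e0)[d' d'0 hd'] := gd s ltac:(lra).
  exists (Num.min d d'); first by rewrite lt_min d0.
  move=> h; rewrite lt_min => /andP[/hd h1 /hd' h2].
  by case: ifPn => // _; rewrite sa fga dfga -sa.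
Qed.

(* [kg a] is [- ln s / 2] for [s >= a], continued in a C2 way by a quadratic
   polynomial for [s <= a]; at [s = |z|^2] it is the fundamental solution of
   the Laplacian smeared out on the disc of radius [sqrt a]. *)
Definition kg a s : R :=
  if s <= a then - ln a / 2 - (s / a - 1) / 2 + (s / a - 1) ^+ 2 / 4
  else - ln s / 2.
(** [kq a] and [kd a] are the first two derivatives of [kg a] in [s]; the maximum in [kd] merges
    both branches and makes continuity immediate. [keta a] is minus the planar Laplacian of
    [kg a (|z|^2)]: a paraboloid cap on the disc of radius [sqrt a], of total mass [2 pi] whatever
    [a]. *)
Definition kq a s : R :=
  if s <= a then (s / a - 2) / (2 * a) else - (2 * s)^-1.
Definition kd a s : R := (2 * Num.max s a ^+ 2)^-1.
Definition keta a s : R := 4 / a * Num.max 0 (1 - s / a).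

Lemma is_derive_lnE s : 0 < s -> is_derive s 1 (@ln R) s^-1.
Proof. exact: is_derive1_ln. Qed.

Lemma is_derive_kg a s : 0 < a -> is_derive s 1 (kg a) (kq a s).
Proof.
move=> a0; apply: (@is_derive_glue
    (fun s => - ln a / 2 - (s / a - 1) / 2 + (s / a - 1) ^+ 2 / 4)
    (fun s => - ln s / 2) (fun s => (s / a - 2) / (2 * a))
    (fun s => - (2 * s)^-1)) => [t ta|t ta||].
- have d1 : is_derive t 1 (fun t => t / a - 1) (1 / a).
    apply: is_derive_eq (is_deriveBE (is_deriveME (is_derive_idE t)
      (is_derive_cstE a^-1 t)) (is_derive_cstE 1 t)) _; ring.
  apply: is_derive_eq (is_deriveDE (is_deriveBE (is_derive_cstE (- ln a / 2) t)
    (is_deriveME d1 (is_derive_cstE 2^-1 t)))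
    (is_deriveME (is_deriveME d1 d1) (is_derive_cstE 4^-1 t))) _.
  by field; lra.
- have t0 : 0 < t by lra.
  apply: is_derive_eq (is_deriveME (is_deriveN (is_derive_lnE t0))
    (is_derive_cstE 2^-1 t)) _.
  by field; lra.
- by field; lra.
- by field; lra.
Qed.

Lemma kdE a s : kd a s = if s <= a then (2 * a ^+ 2)^-1 else (2 * s ^+ 2)^-1.
Proof. by rewrite /kd; case: leP. Qed.

Lemma is_derive_kq a s : 0 < a -> is_derive s 1 (kq a) (kd a s).
Proof.
move=> a0; rewrite kdE; apply: (@is_derive_glue
    (fun s => (s / a - 2) / (2 * a)) (fun s => - (2 * s)^-1)
    (fun=> (2 * a ^+ 2)^-1) (fun s => (2 * s ^+ 2)^-1)) => [t ta|t ta||].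
- apply: is_derive_eq (is_deriveME (is_deriveBE (is_deriveME (is_derive_idE t)
    (is_derive_cstE a^-1 t)) (is_derive_cstE 2 t)) (is_derive_cstE _ t)) _.
  by field; lra.
- have t0 : t != 0 by lra.
  have t2 : 2 * t != 0 by lra.
  apply: is_derive_eq (is_deriveN (is_deriveV t2 (is_deriveZE 2 (is_derive_idE t)))) _.
  by rewrite -[_ *: _]/(_ * _); field; lra.
- by field; lra.
- by [].
Qed.

Lemma continuous_kd a s : 0 < a -> {for s, continuous (kd a)}.
Proof.
move=> a0; have m0 : 0 < Num.max s a by rewrite lt_max a0 orbT.
apply: cvgV; first by rewrite mulf_neq0 ?expf_neq0 ?gt_eqF.
apply: cvgM; first exact: cvg_cst.
have cm : {for s, continuous (fun s => Num.max s a)}.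
  by apply: continuous_max; [exact: cvg_id|exact: cvg_cst].
by apply: cvgM.
Qed.

Lemma continuous_keta a s : {for s, continuous (keta a)}.
Proof.
apply: cvgM; first exact: cvg_cst.
apply: (@continuous_max _ _ (fun=> 0) (fun s => 1 - s / a)); first exact: cvg_cst.
apply: cvgB; first exact: cvg_cst.
by apply: cvgM; [exact: cvg_id|exact: cvg_cst].
Qed.

Lemma kq_kd_keta a s : 0 < a -> 4 * kq a s + 4 * s * kd a s = - keta a s.
Proof.
move=> a0; rewrite /kq kdE /keta; have [sa|sa] := leP s a.
  rewrite max_r ?subr_ge0 ?ler_pdivrMr ?mul1r//; by field; lra.
rewrite max_l ?subr_le0 ?ler_pdivlMr ?mul1r// ?ltW//; by field; lra.
Qed.

Lemma kq_le a s : 0 < a -> a <= s -> kq a s = - (2 * s)^-1.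
Proof.
move=> a0 sa; rewrite /kq; case: ifPn => // sa'.
have -> : s = a by lra.
by field; lra.
Qed.

Lemma kg_le a s : 0 < a -> a <= s -> kg a s = - ln s / 2.
Proof.
move=> a0 sa; rewrite /kg; case: ifPn => // sa'.
have -> : s = a by lra.
by field; lra.
Qed.

Lemma keta_ge0 a s : 0 < a -> 0 <= keta a s.
Proof.
move=> a0; apply: mulr_ge0; first by rewrite divr_ge0// ltW.
by rewrite le_max lexx.
Qed.

Lemma keta_eq0 a s : 0 < a -> a <= s -> keta a s = 0.
Proof.
move=> a0 sa; rewrite /keta max_l ?mulr0//.
by rewrite subr_le0 ler_pdivlMr// mul1r.
Qed.

Lemma keta_le a s : 0 < a -> 0 <= s -> keta a s <= 4 / a.
Proof.
move=> a0 s0; apply: ler_piMr; first by rewrite divr_ge0// ltW.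
by rewrite ge_max ler01 gerBl divr_ge0// ltW.
Qed.

Lemma keta_ge a s : 0 < a -> 4 / a * (1 - s / a) <= keta a s.
Proof.
move=> a0; apply: ler_wpM2l; first by rewrite divr_ge0// ltW.
by rewrite le_max lexx orbT.
Qed.

Lemma ler_MVT f df a b : a <= b ->
  (forall s, a <= s <= b -> is_derive s 1 f (df s)) ->
  (forall s, a <= s <= b -> df s <= 0) -> f b <= f a.
Proof.
move=> ab fd df0.
have cf : {within `[a, b], continuous f}.
  apply: continuous_in_subspaceT => s /set_mem /=; rewrite in_itv/= => /fd.
  exact: is_derive_continuous.
have [|c] := @MVT_segment _ f df a b ab _ cf.
  by move=> s; rewrite in_itv/= => /andP[s1 s2]; apply: fd; rewrite !ltW.
rewrite in_itv/= => hc h; rewrite -subr_le0 h mulr_le0_ge0 ?subr_ge0//.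
exact: df0.
Qed.

(** Integrate twice backwards from [b], where the two profiles and their slopes agree:
    [kd a >= kd b] makes the slope of the difference nonpositive below [b], hence the difference
    nonnegative. *)
Lemma kg_mono a b s : 0 < a -> a <= b -> 0 <= kg a s - kg b s.
Proof.
move=> a0 ab; have b0 : 0 < b by lra.
have [sb|sb] := leP b s; first by rewrite !kg_le// ?subrr//; lra.
have q0 t : t <= b -> kq a t - kq b t <= 0.
  move=> tb; rewrite -(subrr (kq b b)).
  have -> : kq b b - kq b b = kq a b - kq b b by rewrite !kq_le.
  rewrite -lerN2.
  apply: (@ler_MVT (fun t => - (kq a t - kq b t))
                   (fun t => - (kd a t - kd b t)) _ _ tb).
    move=> w _; apply: is_deriveN; apply: is_deriveBE; exact: is_derive_kq.
  move=> w _; rewrite oppr_le0 subr_ge0 /kd.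
  have wa : 0 < Num.max w a by rewrite lt_max a0 orbT.
  have wab : Num.max w a <= Num.max w b.
    by rewrite ge_max !le_max lexx ab orbT.
  rewrite lef_pV2 ?posrE; first by nra.
  - by rewrite mulr_gt0// exprn_gt0// (lt_le_trans wa).
  - by rewrite mulr_gt0// exprn_gt0.
have <- : kg a b - kg b b = 0 by rewrite !kg_le// subrr.
apply: (@ler_MVT (fun t => kg a t - kg b t) (fun t => kq a t - kq b t)).
- exact: ltW.
- move=> t _; apply: is_deriveBE; exact: is_derive_kg.
- by move=> t /andP[_ /q0].
Qed.

End kernel.

(** * Laplacians through derivatives of slices *)

Section laplacian.
Context {R : realType}.
Implicit Types (x y z : R * R) (r s t a b c : R) (u v L : R * R -> R).
Local Notation mu := (@lebesgue_measure R).
Local Notation mu2 := (mu \x mu)%E.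

(** The squared Euclidean distance. Radial functions are written as profiles of it, so that no
    square root is ever differentiated at the centre. *)
Definition N x z : R := (z.1 - x.1) ^+ 2 + (z.2 - x.2) ^+ 2.

Definition partials_at u (ux uy uxx uyy : R * R -> R) z :=
  [/\ {for z, continuous u}, {for z, continuous uxx} & {for z, continuous uyy}]
  /\ [/\ is_derive z.1 1 (fun h => u (h, z.2)) (ux z),
      is_derive z.1 1 (fun h => ux (h, z.2)) (uxx z),
      is_derive z.2 1 (fun h => u (z.1, h)) (uy z) &
      is_derive z.2 1 (fun h => uy (z.1, h)) (uyy z)].

(* [L] is the Laplacian of [u] on [U]; unlike [laplacian], this is a relation
   that is closed under sums without any neighbourhood argument. *)
Definition has_laplacian (U : set (R * R)) u L :=
  exists ux uy uxx uyy : R * R -> R, forall z, U z ->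
  partials_at u ux uy uxx uyy z /\ L z = uxx z + uyy z.

Lemma has_laplacianS (U V : set (R * R)) u L :
  V `<=` U -> has_laplacian U u L -> has_laplacian V u L.
Proof.
move=> VU [ux [uy [uxx [uyy H]]]]; exists ux, uy, uxx, uyy => z Vz.
exact/H/VU.
Qed.

Lemma has_laplacian_continuous U u L : has_laplacian U u L -> continuous_on U u.
Proof. by move=> [ux [uy [uxx [uyy H]]]] z /H[[[]]]. Qed.

Lemma has_laplacianD U u v L L' :
  has_laplacian U u L -> has_laplacian U v L' ->
  has_laplacian U (fun z => u z + v z) (fun z => L z + L' z).
Proof.
move=> [ux [uy [uxx [uyy H]]]] [vx [vy [vxx [vyy H']]]].
exists (fun z => ux z + vx z), (fun z => uy z + vy z),
  (fun z => uxx z + vxx z), (fun z => uyy z + vyy z) => z Uz.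
have [[[c1 c2 c3] [d1 d2 d3 d4]] e] := H _ Uz.
have [[[c1' c2' c3'] [d1' d2' d3' d4']] e'] := H' _ Uz.
split; first by split; split; (exact: cvgD || exact: is_deriveDE).
by rewrite e e'; ring.
Qed.

Lemma has_laplacianZ U k u L : has_laplacian U u L ->
  has_laplacian U (fun z => k * u z) (fun z => k * L z).
Proof.
move=> [ux [uy [uxx [uyy H]]]].
exists (fun z => k * ux z), (fun z => k * uy z),
  (fun z => k * uxx z), (fun z => k * uyy z) => z Uz.
have [[[c1 c2 c3] [d1 d2 d3 d4]] e] := H _ Uz.
split; last by rewrite e; ring.
split; split; try exact: is_deriveZE.
- by apply: cvgM => //; exact: cvg_cst.
- by apply: cvgM => //; exact: cvg_cst.
- by apply: cvgM => //; exact: cvg_cst.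
Qed.

Lemma has_laplacianN U u L : has_laplacian U u L ->
  has_laplacian U (fun z => - u z) (fun z => - L z).
Proof.
move=> /(has_laplacianZ (-1)).
rewrite (_ : (fun z => -1 * u z) = (fun z => - u z)).
  rewrite (_ : (fun z => -1 * L z) = (fun z => - L z))//.
  by apply/funext => z; rewrite mulN1r.
by apply/funext => z; rewrite mulN1r.
Qed.

Lemma has_laplacian_eq U u L L' : (forall z, U z -> L z = L' z) ->
  has_laplacian U u L -> has_laplacian U u L'.
Proof.
move=> LL [ux [uy [uxx [uyy H]]]]; exists ux, uy, uxx, uyy => z Uz.
by have [? e] := H z Uz; rewrite -LL.
Qed.

Lemma has_laplacian_cst U k : has_laplacian U (fun=> k) (fun=> 0).
Proof.
exists (fun=> 0), (fun=> 0), (fun=> 0), (fun=> 0) => z _.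
split; first by split; split; (exact: cvg_cst || exact: is_derive_cstE).
by rewrite addr0.
Qed.

Lemma is_derive_N1 x z : is_derive z.1 1 (fun h => N x (h, z.2)) (2 * (z.1 - x.1)).
Proof.
have d : is_derive z.1 1 (fun h => h - x.1) 1.
  by apply: is_derive_eq (is_deriveBE (is_derive_idE _) (is_derive_cstE _ _)) _; ring.
apply: is_derive_eq (is_deriveDE (is_deriveME d d)
  (is_derive_cstE ((z.2 - x.2) ^+ 2) _)) _.
ring.
Qed.

Lemma is_derive_N2 x z : is_derive z.2 1 (fun h => N x (z.1, h)) (2 * (z.2 - x.2)).
Proof.
have d : is_derive z.2 1 (fun h => h - x.2) 1.
  by apply: is_derive_eq (is_deriveBE (is_derive_idE _) (is_derive_cstE _ _)) _; ring.
apply: is_derive_eq (is_deriveDE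
  (is_derive_cstE ((z.1 - x.1) ^+ 2) _) (is_deriveME d d)) _.
ring.
Qed.

Lemma is_derive_B1 k x z : is_derive z.1 1 (fun h => k * (h - x.1)) k.
Proof.
apply: is_derive_eq (is_deriveZE _ (is_deriveBE (is_derive_idE _) (is_derive_cstE _ _))) _.
ring.
Qed.

Lemma is_derive_B2 k x z : is_derive z.2 1 (fun h => k * (h - x.2)) k.
Proof.
apply: is_derive_eq (is_deriveZE _ (is_deriveBE (is_derive_idE _) (is_derive_cstE _ _))) _.
ring.
Qed.

Lemma continuous_fst z : {for z, continuous (fun w : R * R => w.1)}.
Proof. exact: cvg_fst. Qed.

Lemma continuous_snd z : {for z, continuous (fun w : R * R => w.2)}.
Proof. exact: cvg_snd. Qed.

Lemma continuous_B1 x z : {for z, continuous (fun w : R * R => w.1 - x.1)}.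
Proof. by apply: cvgB; [exact: continuous_fst|exact: cvg_cst]. Qed.

Lemma continuous_B2 x z : {for z, continuous (fun w : R * R => w.2 - x.2)}.
Proof. by apply: cvgB; [exact: continuous_snd|exact: cvg_cst]. Qed.

Lemma continuous_N x z : {for z, continuous (N x)}.
Proof.
apply: cvgD.
  by apply: cvgM; exact: continuous_B1.
by apply: cvgM; exact: continuous_B2.
Qed.

Lemma partials_at_radial x (p p1 p2 : R -> R) z :
  is_derive (N x z) 1 p (p1 (N x z)) ->
  is_derive (N x z) 1 p1 (p2 (N x z)) ->
  {for N x z, continuous p2} ->
  partials_at (fun z => p (N x z))
  (fun z => p1 (N x z) * (2 * (z.1 - x.1)))
  (fun z => p1 (N x z) * (2 * (z.2 - x.2)))
  (fun z => p2 (N x z) * (2 * (z.1 - x.1)) * (2 * (z.1 - x.1)) + p1 (N x z) * 2)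
  (fun z => p2 (N x z) * (2 * (z.2 - x.2)) * (2 * (z.2 - x.2)) + p1 (N x z) * 2)
  z.
Proof.
move=> d1 d2 c2.
have cp : {for z, continuous (fun z => p (N x z))}.
  apply: (@continuous_comp _ _ _ (N x) p); first exact: continuous_N.
  exact: is_derive_continuous d1.
have cp1 : {for z, continuous (fun z => p1 (N x z))}.
  apply: (@continuous_comp _ _ _ (N x) p1); first exact: continuous_N.
  exact: is_derive_continuous d2.
have cp2 : {for z, continuous (fun z => p2 (N x z))}.
  by apply: (@continuous_comp _ _ _ (N x) p2); first exact: continuous_N.
have c1' : {for z, continuous (fun z : R * R => 2 * (z.1 - x.1))}.
  by apply: cvgM; [exact: cvg_cst|exact: continuous_B1].
have c2' : {for z, continuous (fun z : R * R => 2 * (z.2 - x.2))}.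
  by apply: cvgM; [exact: cvg_cst|exact: continuous_B2].
have n1 := is_derive_N1 x z; have n2 := is_derive_N2 x z.
have b1 := is_derive_B1 2 x z; have b2 := is_derive_B2 2 x z.
have C1 := @is_derive_compE _ p1 (fun h => N x (h, z.2)) z.1 _ _ d2 n1.
have C2 := @is_derive_compE _ p1 (fun h => N x (z.1, h)) z.2 _ _ d2 n2.
have E : N x (z.1, z.2) = N x z by rewrite -surjective_pairing.
split; split.
- exact: cp.
- apply: cvgD; first exact: (cvgM (cvgM cp2 c1') c1').
  exact: (cvgM cp1 (cvg_cst _)).
- apply: cvgD; first exact: (cvgM (cvgM cp2 c2') c2').
  exact: (cvgM cp1 (cvg_cst _)).
- exact: (@is_derive_compE _ p (fun h => N x (h, z.2)) z.1 _ _ d1 n1).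
- by have := is_deriveME C1 b1; rewrite /= E; apply.
- exact: (@is_derive_compE _ p (fun h => N x (z.1, h)) z.2 _ _ d1 n2).
- by have := is_deriveME C2 b2; rewrite /= E; apply.
Qed.

Lemma has_laplacian_radial U x (p p1 p2 : R -> R) :
  (forall z, U z -> [/\ is_derive (N x z) 1 p (p1 (N x z)),
    is_derive (N x z) 1 p1 (p2 (N x z)) & {for N x z, continuous p2}]) ->
  has_laplacian U (fun z => p (N x z))
    (fun z => 4 * p1 (N x z) + 4 * N x z * p2 (N x z)).
Proof.
move=> H; do 4 eexists; move=> z Uz; have [d1 d2 c2] := H z Uz.
by split; [exact: partials_at_radial d1 d2 c2|rewrite /= /N; ring].
Qed.

Lemma N_ge0 x z : 0 <= N x z.
Proof. by rewrite addr_ge0// sqr_ge0. Qed.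

End laplacian.

(** * Mean value inequalities *)

Section mean_value.
Context {R : realType}.
Implicit Types (x y z : R * R) (r s t a b c : R) (u v L : R * R -> R).
Local Notation mu := (@lebesgue_measure R).
Local Notation mu2 := (mu \x mu)%E.

Lemma sq_integralD y r u v : continuous_on (sq y r) u ->
  continuous_on (sq y r) v ->
  \int[mu2]_(z in sq y r) (u z + v z) =
  \int[mu2]_(z in sq y r) u z + \int[mu2]_(z in sq y r) v z.
Proof.
move=> cu cv; apply: RintegralD; first exact: measurable_sq.
  exact: continuous_on_integrable.
exact: continuous_on_integrable.
Qed.

Lemma sq_integralB y r u v : continuous_on (sq y r) u ->
  continuous_on (sq y r) v ->
  \int[mu2]_(z in sq y r) (u z - v z) =
  \int[mu2]_(z in sq y r) u z - \int[mu2]_(z in sq y r) v z.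
Proof.
move=> cu cv; apply: RintegralB; first exact: measurable_sq.
  exact: continuous_on_integrable.
exact: continuous_on_integrable.
Qed.

Lemma sq_integralZ y r k u : continuous_on (sq y r) u ->
  \int[mu2]_(z in sq y r) (k * u z) = k * \int[mu2]_(z in sq y r) u z.
Proof.
move=> cu; apply: RintegralZl; first exact: measurable_sq.
exact: continuous_on_integrable.
Qed.

Lemma sq_integral_le y r u v : continuous_on (sq y r) u ->
  continuous_on (sq y r) v -> (forall z, sq y r z -> u z <= v z) ->
  \int[mu2]_(z in sq y r) u z <= \int[mu2]_(z in sq y r) v z.
Proof.
move=> cu cv uv; apply: le_Rintegral => //; first exact: measurable_sq.
  exact: continuous_on_integrable.
exact: continuous_on_integrable.
Qed.

Lemma continuous_onD A u v : continuous_on A u -> continuous_on A v ->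
  continuous_on A (fun z => u z + v z).
Proof. by move=> cu cv z Az; apply: cvgD; [exact: cu|exact: cv]. Qed.

Lemma continuous_onB A u v : continuous_on A u -> continuous_on A v ->
  continuous_on A (fun z => u z - v z).
Proof. by move=> cu cv z Az; apply: cvgB; [exact: cu|exact: cv]. Qed.

Lemma continuous_onM A u v : continuous_on A u -> continuous_on A v ->
  continuous_on A (fun z => u z * v z).
Proof. by move=> cu cv z Az; apply: cvgM; [exact: cu|exact: cv]. Qed.

Lemma continuous_on_cst (A : set (R * R)) (k : R) : continuous_on A (fun=> k).
Proof. by move=> z Az; exact: cvg_cst. Qed.

(** Green's second identity: [u vxx - v uxx] is the first partial derivative of [u vx - v ux], which
    vanishes on the vertical sides; likewise in the second coordinate. *)
Lemma green y r u ux uy uxx uyy v vx vy vxx vyy : 0 < r ->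
  (forall z, sq y r z -> partials_at u ux uy uxx uyy z) ->
  (forall z, sq y r z -> partials_at v vx vy vxx vyy z) ->
  (forall z, sq y r z -> `|z.1 - y.1| = r -> v z = 0 /\ vx z = 0) ->
  (forall z, sq y r z -> `|z.2 - y.2| = r -> v z = 0 /\ vy z = 0) ->
  \int[mu2]_(z in sq y r) (u z * (vxx z + vyy z)) =
  \int[mu2]_(z in sq y r) (v z * (uxx z + uyy z)).
Proof.
move=> r0 pu pv v1 v2.
have cu : continuous_on (sq y r) u by move=> z /pu[[]].
have cv : continuous_on (sq y r) v by move=> z /pv[[]].
have cuxx : continuous_on (sq y r) uxx by move=> z /pu[[]].
have cuyy : continuous_on (sq y r) uyy by move=> z /pu[[]].
have cvxx : continuous_on (sq y r) vxx by move=> z /pv[[]].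
have cvyy : continuous_on (sq y r) vyy by move=> z /pv[[]].
have c1 : continuous_on (sq y r) (fun z => u z * vxx z - v z * uxx z).
  by apply: continuous_onB; exact: continuous_onM.
have c2 : continuous_on (sq y r) (fun z => u z * vyy z - v z * uyy z).
  by apply: continuous_onB; exact: continuous_onM.
have i1 : \int[mu2]_(z in sq y r) (u z * vxx z - v z * uxx z) = 0.
  apply: (@sq_integral_d1_eq0 _ y r _ (fun z => u z * vx z - v z * ux z) r0 c1).
    move=> z Qz; have [_ [d1 d2 _ _]] := pu z Qz; have [_ [e1 e2 _ _]] := pv z Qz.
    apply: is_derive_eq (is_deriveBE (is_deriveME d1 e2) (is_deriveME e1 d2)) _.
    by case: z {Qz d1 d2 e1 e2} => z1 z2 /=; ring.
  move=> b hb.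
  have [||-> ->] := v1 (y.1 - r, b).
  - by split => //=; rewrite ler_distl; lra.
  - by rewrite /= addrAC subrr add0r normrN gtr0_norm.
  have [||-> ->] := v1 (y.1 + r, b); last by ring.
  - by split => //=; rewrite ler_distl; lra.
  - by rewrite /= addrAC subrr add0r gtr0_norm.
have i2 : \int[mu2]_(z in sq y r) (u z * vyy z - v z * uyy z) = 0.
  apply: (@sq_integral_d2_eq0 _ y r _ (fun z => u z * vy z - v z * uy z) r0 c2).
    move=> z Qz; have [_ [_ _ d1 d2]] := pu z Qz; have [_ [_ _ e1 e2]] := pv z Qz.
    apply: is_derive_eq (is_deriveBE (is_deriveME d1 e2) (is_deriveME e1 d2)) _.
    by case: z {Qz d1 d2 e1 e2} => z1 z2 /=; ring.
  move=> b hb.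
  have [||-> ->] := v2 (b, y.2 - r).
  - by split => //=; rewrite ler_distl; lra.
  - by rewrite /= addrAC subrr add0r normrN gtr0_norm.
  have [||-> ->] := v2 (b, y.2 + r); last by ring.
  - by split => //=; rewrite ler_distl; lra.
  - by rewrite /= addrAC subrr add0r gtr0_norm.
apply/eqP; rewrite -subr_eq0 -sq_integralB; last 2 first.
- by apply: continuous_onM => //; exact: continuous_onD.
- by apply: continuous_onM => //; exact: continuous_onD.
rewrite (_ : (fun z => _) = (fun z => (u z * vxx z - v z * uxx z) +
                            (u z * vyy z - v z * uyy z))).
  by rewrite sq_integralD// i1 i2 addr0.
by apply/funext => z; ring.
Qed.

(* The identity behind the mean value property: the profile is
   [kg e - kg a], whose Laplacian is [keta a - keta e]. *)
Lemma green_kernel y r x e a u ux uy uxx uyy : 0 < r -> 0 < e <= a ->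
  sq x (Num.sqrt a) `<=` sq y r ->
  (forall z, sq y r z -> partials_at u ux uy uxx uyy z) ->
  \int[mu2]_(z in sq y r) (u z * (keta a (N x z) - keta e (N x z))) =
  \int[mu2]_(z in sq y r) ((kg e (N x z) - kg a (N x z)) * (uxx z + uyy z)).
Proof.
move=> r0 /andP[e0 ea] Q pu; have a0 : 0 < a by lra.
have sa0 : 0 < Num.sqrt a by rewrite sqrtr_gt0.
have sqa : Num.sqrt a ^+ 2 = a by rewrite sqr_sqrtr// ltW.
pose p s := kg e s - kg a s; pose p1 s := kq e s - kq a s.
pose p2 s := kd e s - kd a s.
have pv z : partials_at (fun z => p (N x z))
  (fun z => p1 (N x z) * (2 * (z.1 - x.1)))
  (fun z => p1 (N x z) * (2 * (z.2 - x.2)))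
  (fun z => p2 (N x z) * (2 * (z.1 - x.1)) * (2 * (z.1 - x.1)) + p1 (N x z) * 2)
  (fun z => p2 (N x z) * (2 * (z.2 - x.2)) * (2 * (z.2 - x.2)) + p1 (N x z) * 2)
  z.
  apply: partials_at_radial.
  - by apply: is_deriveBE; exact: is_derive_kg.
  - by apply: is_deriveBE; exact: is_derive_kq.
  - by apply: cvgB; exact: continuous_kd.
have pa s : a <= s -> p s = 0 /\ p1 s = 0.
  by move=> sa; rewrite /p /p1 !kg_le ?kq_le ?subrr//; lra.
(* These four inequalities keep the sides of [sq y r] at distance at least [sqrt a] from [x], so
   that the profile and its slope vanish on them. *)
have h1 : y.1 - r <= x.1 - Num.sqrt a.
  have [|] := Q (x.1 - Num.sqrt a, x.2).
    split => /=; first by rewrite addrAC subrr add0r normrN gtr0_norm.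
    by rewrite subrr normr0 ltW.
  by rewrite /= ler_distl; lra.
have h2 : x.1 + Num.sqrt a <= y.1 + r.
  have [|] := Q (x.1 + Num.sqrt a, x.2).
    split => /=; first by rewrite addrAC subrr add0r gtr0_norm.
    by rewrite subrr normr0 ltW.
  by rewrite /= ler_distl; lra.
have h3 : y.2 - r <= x.2 - Num.sqrt a.
  have [|_] := Q (x.1, x.2 - Num.sqrt a).
    split => /=; last by rewrite addrAC subrr add0r normrN gtr0_norm.
    by rewrite subrr normr0 ltW.
  by rewrite /= ler_distl; lra.
have h4 : x.2 + Num.sqrt a <= y.2 + r.
  have [|_] := Q (x.1, x.2 + Num.sqrt a).
    split => /=; last by rewrite addrAC subrr add0r gtr0_norm.
    by rewrite subrr normr0 ltW.
  by rewrite /= ler_distl; lra.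
have abs1 t : `|t| = r -> t = r \/ t = - r.
  by case: (leP 0 t) => ht; [rewrite ger0_norm//; left|rewrite ltr0_norm//; right; lra].
transitivity (\int[mu2]_(z in sq y r) (u z *
   ((p2 (N x z) * (2 * (z.1 - x.1)) * (2 * (z.1 - x.1)) + p1 (N x z) * 2)
  + (p2 (N x z) * (2 * (z.2 - x.2)) * (2 * (z.2 - x.2)) + p1 (N x z) * 2)))).
  apply: eq_Rintegral => z _; congr (_ * _).
  have := kq_kd_keta (N x z) e0; have := kq_kd_keta (N x z) a0.
  move=> E1 E2.
  have -> : keta a (N x z) - keta e (N x z) =
    4 * p1 (N x z) + 4 * N x z * p2 (N x z) by rewrite /p1 /p2; lra.
  by rewrite {2}/N; ring.
apply: (green r0 pu (fun z _ => pv z)) => z Qz hz.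
  have /pa[-> ->] : a <= N x z; last by rewrite mul0r.
  rewrite -sqa /N; have := sqr_ge0 (z.2 - x.2); case: (abs1 _ hz) => hz'; nra.
have /pa[-> ->] : a <= N x z; last by rewrite mul0r.
rewrite -sqa /N; have := sqr_ge0 (z.1 - x.1); case: (abs1 _ hz) => hz'; nra.
Qed.

Lemma continuous_keta_N x a z : {for z, continuous (fun z => keta a (N x z))}.
Proof.
apply: (@continuous_comp _ _ _ (N x) (keta a)); first exact: continuous_N.
exact: continuous_keta.
Qed.

Lemma continuous_kg_N x a z : 0 < a ->
  {for z, continuous (fun z => kg a (N x z))}.
Proof.
move=> a0.
apply: (@continuous_comp _ _ _ (N x) (kg a)); first exact: continuous_N.
exact: is_derive_continuous (is_derive_kg _ a0).
Qed.

(** Green's identity against the constant [1]: the mass of the bump does not depend on its width. *)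
Lemma keta_integral y r x e a : 0 < r -> 0 < e <= a ->
  sq x (Num.sqrt a) `<=` sq y r ->
  \int[mu2]_(z in sq y r) keta e (N x z) = \int[mu2]_(z in sq y r) keta a (N x z).
Proof.
move=> r0 ea Q; apply/esym/eqP; rewrite -subr_eq0 -sq_integralB; last 2 first.
- by move=> z _; exact: continuous_keta_N.
- by move=> z _; exact: continuous_keta_N.
have [ux [uy [uxx [uyy H]]]] := has_laplacian_cst (sq y r) (1 : R).
have := green_kernel r0 ea Q (fun z Qz => (H z Qz).1).
rewrite (_ : (fun z => 1 * _) =
  (fun z => keta a (N x z) - keta e (N x z))); last by apply/funext => z; rewrite mul1r.
move=> ->; rewrite (@eq_Rintegral _ _ _ _ _ (fun=> 0)) ?Rintegral_cst ?mul0r//.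
  exact: measurable_sq.
by move=> z /set_mem Qz; rewrite -(H z Qz).2 mulr0.
Qed.

(** Green's identity against [|z - x|^2 / 4], whose Laplacian is [1]; on the support of [keta a]
    that function is at most [a / 4]. *)
Lemma kg_integral y r x e a : 0 < r -> 0 < e <= a ->
  sq x (Num.sqrt a) `<=` sq y r ->
  \int[mu2]_(z in sq y r) (kg e (N x z) - kg a (N x z)) <=
  a / 4 * \int[mu2]_(z in sq y r) keta a (N x z).
Proof.
move=> r0 ea Q; have /andP[e0 ea'] := ea; have a0 : 0 < a by lra.
have [|ux [uy [uxx [uyy H]]]] := @has_laplacian_radial _ (sq y r) x
  (fun s => s / 4) (fun=> 4^-1) (fun=> 0).
  move=> z _; split; [|exact: is_derive_cstE|exact: cvg_cst].
  by apply: is_derive_eq (is_deriveME (is_derive_idE _) (is_derive_cstE _ _)) _; ring.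
have := green_kernel r0 ea Q (fun z Qz => (H z Qz).1).
have -> : \int[mu2]_(z in sq y r)
    ((kg e (N x z) - kg a (N x z)) * (uxx z + uyy z)) =
  \int[mu2]_(z in sq y r) (kg e (N x z) - kg a (N x z)).
  by apply: eq_Rintegral => z /set_mem Qz; rewrite -(H z Qz).2; field.
move=> <-; rewrite -sq_integralZ; last by move=> z _; exact: continuous_keta_N.
apply: sq_integral_le.
- apply: continuous_onM => z Qz.
    by apply: cvgM; [exact: continuous_N|exact: cvg_cst].
  by apply: cvgB; exact: continuous_keta_N.
- apply: continuous_onM => z Qz; first exact: cvg_cst.
  exact: continuous_keta_N.
- move=> z _; have E0 := keta_ge0 (N x z) e0; have A0 := keta_ge0 (N x z) a0.
  have n0 := N_ge0 x z; have [na|na] := leP a (N x z).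
    by rewrite (keta_eq0 a0 na); nra.
  by nra.
Qed.

(** As [e] shrinks, [keta e] concentrates at [x] with unchanged mass, so its integral against [u]
    approaches [u x] times the mass. The error is [- c] against the nonnegative kernel
    [kg e - kg a], whose integral is bounded uniformly in [e]. *)
Theorem mean_value_le y r x a c u L : 0 < r -> 0 < a -> 0 <= c ->
  sq x (Num.sqrt a) `<=` sq y r -> has_laplacian (sq y r) u L ->
  (forall z, sq y r z -> - c <= L z) ->
  u x * \int[mu2]_(z in sq y r) keta a (N x z) <=
  \int[mu2]_(z in sq y r) (u z * keta a (N x z)) +
  c * (a / 4) * \int[mu2]_(z in sq y r) keta a (N x z).
Proof.
move=> r0 a0 c0 Q uL Lc; have cu := has_laplacian_continuous uL.
have [ux [uy [uxx [uyy H]]]] := uL.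
set J := \int[mu2]_(z in sq y r) keta a (N x z).
have J0 : 0 <= J by apply: Rintegral_ge0 => z _; exact: keta_ge0.
have ce b : continuous_on (sq y r) (fun z => keta b (N x z)).
  by move=> z _; exact: continuous_keta_N.
have sa0 : 0 < Num.sqrt a by rewrite sqrtr_gt0.
have Qx : sq y r x by apply: Q; split; rewrite subrr normr0 ltW.
suff S d : 0 < d -> (u x - d) * J <=
    \int[mu2]_(z in sq y r) (u z * keta a (N x z)) + c * (a / 4) * J.
  clearbody J; rewrite -subr_ge0; apply/ler_addgt0Pr => d d0.
  have J1 : 0 < J + 1 by lra.
  (* Only [0 <= J] is known here, hence the denominator [J + 1]. *)
  have := S (d / (J + 1)) ltac:(by rewrite divr_gt0).
  have : d / (J + 1) * J <= d.
    by rewrite mulrAC ler_pdivrMr// ler_wpM2l ?ltW//; lra.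
  set I := Rintegral _ _ _; clearbody I; move=> h1 h2; lra.
move=> d0.
have [b b0 hb] : exists2 b, 0 < b & sq x b `<=` [set z | `|u x - u z| < d].
  by apply: near_sq; have /cvgrPdist_lt/(_ _ d0) := cu x Qx.
(* The support of [keta e] then lies in [sq x b], where [u] is within [d] of [u x]. *)
pose e := Num.min a (b ^+ 2).
have e0 : 0 < e by rewrite lt_min a0 exprn_gt0.
have ea : 0 < e <= a by rewrite e0 ge_min lexx.
have eb : e <= b ^+ 2 by rewrite ge_min lexx orbT.
have := green_kernel r0 ea Q (fun z Qz => (H z Qz).1).
have -> : (fun z => u z * (keta a (N x z) - keta e (N x z))) =
  (fun z => u z * keta a (N x z) - u z * keta e (N x z)).
  by apply/funext => z; ring.
rewrite sq_integralB; [|exact: continuous_onM|exact: continuous_onM].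
have : (u x - d) * J <= \int[mu2]_(z in sq y r) (u z * keta e (N x z)).
  rewrite /J -(keta_integral r0 ea Q) -sq_integralZ//.
  apply: sq_integral_le.
  - by apply: continuous_onM => //; exact: continuous_on_cst.
  - exact: continuous_onM.
  move=> z Qz; have [ne|ne] := leP e (N x z).
    by rewrite (keta_eq0 e0 ne) !mulr0.
  apply: ler_wpM2r; first exact: keta_ge0.
  have : sq x b z.
    have := ltW ne; have := eb; rewrite /N => h1 h2.
    split; rewrite -ler_sqr ?nnegrE ?(ltW b0)// real_normK ?num_real//.
      by have := sqr_ge0 (z.2 - x.2); lra.
    by have := sqr_ge0 (z.1 - x.1); lra.
  by move=> /hb/=; rewrite ltr_distl; lra.
have : - (c * (a / 4) * J) <= \int[mu2]_(z in sq y r)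
   ((kg e (N x z) - kg a (N x z)) * (uxx z + uyy z)).
  have ck : continuous_on (sq y r) (fun z => kg e (N x z) - kg a (N x z)).
    by move=> z _; apply: cvgB; exact: continuous_kg_N.
  apply: (@le_trans _ _ (- c * \int[mu2]_(z in sq y r) (kg e (N x z) - kg a (N x z)))).
    have := kg_integral r0 ea Q; rewrite -/J; clearbody J.
    by set I := Rintegral _ _ _; clearbody I => h; nra.
  rewrite -sq_integralZ//; apply: sq_integral_le.
  - by apply: continuous_onM => //; exact: continuous_on_cst.
  - apply: continuous_onM => //; apply: continuous_onD => z /H[[[]]] //.
  move=> z Qz; rewrite -(H z Qz).2 mulrC; apply: ler_wpM2l; last exact: Lc.
  by have /andP[] := ea => *; exact: kg_mono.
move: J {J0}; do 3 (set I := Rintegral _ _ _; clearbody I; move: I).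
move=> I1 I2 I3 J h1 h2 h3; lra.
Qed.

Theorem mean_value_ge y r x a c u L : 0 < r -> 0 < a -> 0 <= c ->
  sq x (Num.sqrt a) `<=` sq y r -> has_laplacian (sq y r) u L ->
  (forall z, sq y r z -> L z <= c) ->
  \int[mu2]_(z in sq y r) (u z * keta a (N x z)) <=
  u x * \int[mu2]_(z in sq y r) keta a (N x z) +
  c * (a / 4) * \int[mu2]_(z in sq y r) keta a (N x z).
Proof.
move=> r0 a0 c0 Q uL Lc; have cu := has_laplacian_continuous uL.
have ce : continuous_on (sq y r) (fun z => keta a (N x z)).
  by move=> z _; exact: continuous_keta_N.
have := mean_value_le r0 a0 c0 Q (has_laplacianN uL).
have -> : (fun z => - u z * keta a (N x z)) = (fun z => -1 * (u z * keta a (N x z))).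
  by apply/funext => z; ring.
rewrite (sq_integralZ (-1) (continuous_onM cu ce)).
have H z : sq y r z -> - c <= - L z by move=> /Lc; lra.
by move=> /(_ H); lra.
Qed.

End mean_value.

(** * Harnack inequality *)

Section harnack.
Context {R : realType}.
Implicit Types (x y z : R * R) (r s t a b c : R) (u v L : R * R -> R).
Local Notation mu := (@lebesgue_measure R).
Local Notation mu2 := (mu \x mu)%E.

Lemma enorm_ge0 z : 0 <= enorm z.
Proof. exact: sqrtr_ge0. Qed.

Lemma sqr_enorm z : enorm z ^+ 2 = z.1 ^+ 2 + z.2 ^+ 2.
Proof. by rewrite sqr_sqrtr// addr_ge0// sqr_ge0. Qed.

Lemma enorm_le z r : 0 <= r -> z.1 ^+ 2 + z.2 ^+ 2 <= r ^+ 2 -> enorm z <= r.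
Proof. by move=> r0 h; rewrite -ler_sqr ?nnegrE ?enorm_ge0// sqr_enorm. Qed.

Lemma enormD x y : enorm (x + y) <= enorm x + enorm y.
Proof.
have x0 := enorm_ge0 x; have y0 := enorm_ge0 y.
apply: enorm_le; first exact: addr_ge0.
have := sqr_enorm x; have := sqr_enorm y.
rewrite /= => ey ex.
have : x.1 * y.1 + x.2 * y.2 <= enorm x * enorm y.
  rewrite (le_trans (ler_norm _))// -ler_sqr ?nnegrE ?mulr_ge0//.
  rewrite real_normK ?num_real// exprMn ex ey.
  have := sqr_ge0 (x.1 * y.2 - x.2 * y.1); lra.
by nra.
Qed.

Lemma enormN x : enorm (- x) = enorm x.
Proof. by rewrite /enorm /= !sqrrN. Qed.

Lemma enormB x y : enorm (x - y) = enorm (y - x).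
Proof. by rewrite -enormN opprB. Qed.

Lemma enorm_sub x y : enorm x - enorm y <= enorm (x - y).
Proof. by have := enormD (x - y) y; rewrite subrK; lra. Qed.

Lemma normr1_enorm z : `|z.1| <= enorm z.
Proof.
rewrite -ler_sqr ?nnegrE ?enorm_ge0// sqr_enorm real_normK ?num_real//.
by have := sqr_ge0 z.2; lra.
Qed.

Lemma normr2_enorm z : `|z.2| <= enorm z.
Proof.
rewrite -ler_sqr ?nnegrE ?enorm_ge0// sqr_enorm real_normK ?num_real//.
by have := sqr_ge0 z.1; lra.
Qed.

(** [3 / 2] is a rational bound for [sqrt 2]. *)
Lemma sq_enorm x r z : sq x r z -> enorm (z - x) <= 3 / 2 * r.
Proof.
move=> [/= h1 h2]; have r0 : 0 <= r := le_trans (normr_ge0 _) h1.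
apply: enorm_le; first lra.
have g1 : (z.1 - x.1) ^+ 2 <= r ^+ 2.
  by rewrite -real_normK ?num_real// ler_sqr ?nnegrE.
have g2 : (z.2 - x.2) ^+ 2 <= r ^+ 2.
  by rewrite -real_normK ?num_real// ler_sqr ?nnegrE.
by rewrite /=; nra.
Qed.

Lemma enorm_sq x z r : enorm (z - x) <= r -> sq x r z.
Proof.
move=> h; split.
  exact: le_trans (normr1_enorm (z - x)) h.
exact: le_trans (normr2_enorm (z - x)) h.
Qed.


Lemma sq_trans x y z r s : sq y r x -> sq x s z -> sq y (r + s) z.
Proof.
move=> [a1 a2] [b1 b2]; split.
  by have := ler_normD (z.1 - x.1) (x.1 - y.1); rewrite addrA subrK; lra.
by have := ler_normD (z.2 - x.2) (x.2 - y.2); rewrite addrA subrK; lra.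
Qed.

Lemma sq_le x r s : r <= s -> sq x r `<=` sq x s.
Proof. by move=> rs z [z1 z2]; split; lra. Qed.

Lemma sq_integral_subset x y r s u : sq x s `<=` sq y r ->
  continuous_on (sq y r) u -> (forall z, sq y r z -> 0 <= u z) ->
  \int[mu2]_(z in sq x s) u z <= \int[mu2]_(z in sq y r) u z.
Proof.
move=> Q cu u0.
have cu' : continuous_on (sq x s) u by move=> z /Q; exact: cu.
apply: fine_le.
- apply: integrable_fin_num; first exact: measurable_sq.
  exact: continuous_on_integrable.
- apply: integrable_fin_num; first exact: measurable_sq.
  exact: continuous_on_integrable.
- apply: ge0_subset_integral => //.
  + exact: measurable_sq.
  + exact: measurable_sq.
  + apply/measurable_EFinP; apply: continuous_on_measurable => //.
    exact: measurable_sq.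
Qed.

Lemma sq_integral_cst x r k : 0 <= r ->
  \int[mu2]_(z in sq x r) k = k * (2 * r) ^+ 2.
Proof.
move=> r0; rewrite Rintegral_cst; last exact: measurable_sq.
by rewrite [X in fine X](measure_sq x r0).
Qed.

Lemma N_sq x z b : sq x b z -> N x z <= 2 * b ^+ 2.
Proof.
move=> [h1 h2]; have r0 : 0 <= b := le_trans (normr_ge0 _) h1.
have g1 : (z.1 - x.1) ^+ 2 <= b ^+ 2.
  by rewrite -real_normK ?num_real// ler_sqr ?nnegrE.
have g2 : (z.2 - x.2) ^+ 2 <= b ^+ 2.
  by rewrite -real_normK ?num_real// ler_sqr ?nnegrE.
by rewrite /N; lra.
Qed.

(** On the concentric square of area [a] the squared distance is at most [a / 2], so the bump is at
    least [2 / a] there. *)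
Lemma keta_integral_ge y r x a : 0 < a -> sq x (Num.sqrt a) `<=` sq y r ->
  2 <= \int[mu2]_(z in sq y r) keta a (N x z).
Proof.
move=> a0 Q; have sa0 : 0 < Num.sqrt a by rewrite sqrtr_gt0.
have sqa : Num.sqrt a ^+ 2 = a by rewrite sqr_sqrtr// ltW.
have Q' : sq x (Num.sqrt a / 2) `<=` sq y r.
  by move=> z h; apply: Q; apply: sq_le h; lra.
apply: (@le_trans _ _ (\int[mu2]_(z in sq x (Num.sqrt a / 2)) keta a (N x z))); last first.
  apply: sq_integral_subset => // z _; first exact: continuous_keta_N.
  exact: keta_ge0.
apply: (@le_trans _ _ (\int[mu2]_(z in sq x (Num.sqrt a / 2)) (2 / a))).
  rewrite sq_integral_cst; last lra.
  have -> : 2 * (Num.sqrt a / 2) = Num.sqrt a by field.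
  by rewrite sqa divfK// gt_eqF.
apply: sq_integral_le.
- exact: continuous_on_cst.
- by move=> z _; exact: continuous_keta_N.
move=> z /N_sq h; apply: le_trans (keta_ge (N x z) a0).
have h' : N x z <= a / 2.
  move: h; have -> : (Num.sqrt a / 2) ^+ 2 = a / 4 by rewrite -[in RHS]sqa; field.
  by move=> h; lra.
have -> : 2 / a = 4 / a * (1 / 2) by field; lra.
rewrite ler_pM2l ?divr_gt0//.
have : N x z / a <= 1 / 2 by rewrite ler_pdivrMr//; lra.
lra.
Qed.

Lemma keta_integral_le y r x a : 0 < a -> 0 <= r ->
  \int[mu2]_(z in sq y r) keta a (N x z) <= 16 * r ^+ 2 / a.
Proof.
move=> a0 r0.
have -> : 16 * r ^+ 2 / a = \int[mu2]_(z in sq y r) (4 / a).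
  by rewrite sq_integral_cst//; field; lra.
apply: sq_integral_le.
- by move=> z _; exact: continuous_keta_N.
- exact: continuous_on_cst.
- by move=> z _; apply: keta_le => //; exact: N_ge0.
Qed.

(** The bump of radius [r] at [x] is at most [32] times the bump of radius [4 r] at [y]. The first
    has mass at least [2] and the second at most [16], which gives [32 * 16 / 2 = 256]; the error
    terms add up to [1024 + 1 / 4]. *)
Lemma harnack_sq x y r c v L : 0 < r -> 0 <= c -> sq y r x ->
  has_laplacian (sq y (4 * r)) v L ->
  (forall z, sq y (4 * r) z -> 0 <= v z) ->
  (forall z, sq y (4 * r) z -> `|L z| <= c) ->
  v x <= 256 * v y + 1025 * (c * r ^+ 2).
Proof.
move=> r0 c0 xy vL v0 Lc.
have r2 : 0 < r ^+ 2 by rewrite exprn_gt0.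
have a16 : 0 < 16 * r ^+ 2 by lra.
have r4 : 0 < 4 * r by lra.
have s1 : Num.sqrt (r ^+ 2) = r by rewrite sqrtr_sqr gtr0_norm.
have s16 : Num.sqrt (16 * r ^+ 2) = 4 * r.
  have -> : 16 * r ^+ 2 = (4 * r) ^+ 2 by ring.
  by rewrite sqrtr_sqr gtr0_norm.
have Qx : sq x (Num.sqrt (r ^+ 2)) `<=` sq y (4 * r).
  by rewrite s1 => z /(sq_trans xy); apply: sq_le; lra.
have Qy : sq y (Num.sqrt (16 * r ^+ 2)) `<=` sq y (4 * r) by rewrite s16.
have Lc1 z : sq y (4 * r) z -> - c <= L z by move=> /Lc; rewrite ler_norml; lra.
have Lc2 z : sq y (4 * r) z -> L z <= c by move=> /Lc; rewrite ler_norml; lra.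
have cv := has_laplacian_continuous vL.
have := mean_value_le r4 r2 c0 Qx vL Lc1.
have := mean_value_ge r4 a16 c0 Qy vL Lc2.
have := keta_integral_ge r2 Qx.
have := keta_integral_ge a16 Qy.
have := keta_integral_le y y a16 (ltW r4).
have vx0 : 0 <= v x by apply: v0; apply: sq_le xy; lra.
have vy0 : 0 <= v y by apply: v0; split; rewrite subrr normr0 ltW.
have : \int[mu2]_(z in sq y (4 * r)) (v z * keta (r ^+ 2) (N x z)) <=
   32 * \int[mu2]_(z in sq y (4 * r)) (v z * keta (16 * r ^+ 2) (N y z)).
  rewrite -sq_integralZ; last first.
    by apply: continuous_onM => // z _; exact: continuous_keta_N.
  apply: sq_integral_le.
  - by apply: continuous_onM => // z _; exact: continuous_keta_N.
  - apply: continuous_onM; first exact: continuous_on_cst.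
    by apply: continuous_onM => // z _; exact: continuous_keta_N.
  move=> z Qz; rewrite [leRHS]mulrCA; apply: ler_wpM2l; first exact: v0.
  have [n|n] := leP (r ^+ 2) (N x z).
    by rewrite (keta_eq0 r2 n) mulr_ge0// keta_ge0.
  apply: (le_trans (keta_le r2 (N_ge0 x z))).
  have : 4 / (16 * r ^+ 2) * (1 - N y z / (16 * r ^+ 2)) <= keta (16 * r ^+ 2) (N y z).
    exact: keta_ge.
  have : N y z <= 8 * r ^+ 2.
    have : sq y (r + r) z.
      apply: sq_trans xy _; rewrite /N in n.
      split; rewrite -ler_sqr ?nnegrE ?(ltW r0)// real_normK ?num_real//.
        by have := sqr_ge0 (z.2 - x.2); lra.
      by have := sqr_ge0 (z.1 - x.1); lra.
    by move=> /N_sq; lra.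
  move=> hN hk.
  have : N y z / (16 * r ^+ 2) <= 1 / 2 by rewrite ler_pdivrMr//; lra.
  have -> : 4 / r ^+ 2 = 32 * (4 / (16 * r ^+ 2) * (1 - 1 / 2)) by field; lra.
  move=> h; apply: ler_wpM2l => //; apply: le_trans hk.
  rewrite ler_pM2l ?divr_gt0//; lra.
have -> : 16 * (4 * r) ^+ 2 / (16 * r ^+ 2) = 16 by field; lra.
set Jx := \int[mu2]_(z in sq y (4 * r)) keta (r ^+ 2) (N x z).
set Jy := \int[mu2]_(z in sq y (4 * r)) keta (16 * r ^+ 2) (N y z).
set Ix := \int[mu2]_(z in sq y (4 * r)) (v z * keta (r ^+ 2) (N x z)).
set Iy := \int[mu2]_(z in sq y (4 * r)) (v z * keta (16 * r ^+ 2) (N y z)).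
clearbody Jx Jy Ix Iy => hI hJy hJy2 hJx hy hx.
set d := c * r ^+ 2; have d0 : 0 <= d by rewrite mulr_ge0// ltW.
have dE : c * (16 * r ^+ 2 / 4) = 4 * d by rewrite /d; field.
have dE' : c * (r ^+ 2 / 4) = d / 4 by rewrite /d; field.
rewrite dE in hy; rewrite dE' in hx; clearbody d.
have hIy : Iy <= 16 * v y + 64 * d by nra.
have hx' : (v x - d / 4) * Jx <= 512 * v y + 2048 * d by lra.
have [|h] := leP (v x - d / 4) 0; first lra.
have : (v x - d / 4) * 2 <= (v x - d / 4) * Jx by rewrite ler_pM2l.
lra.
Qed.

(* Adding the constant [5 c r^2] absorbs the error term of [harnack_sq]. *)
Lemma harnack_chain (P : nat -> R * R) n r c v L : 0 < r -> 0 <= c ->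
  (forall k, (k < n)%N -> sq (P k.+1) r (P k)) ->
  (forall k, (k <= n)%N -> has_laplacian (sq (P k) (4 * r)) v L /\
    forall z, sq (P k) (4 * r) z -> 0 <= v z /\ `|L z| <= c) ->
  v (P 0%N) + 5 * (c * r ^+ 2) <=
  256 ^+ n * (v (P n) + 5 * (c * r ^+ 2)).
Proof.
move=> r0 c0; elim: n => [|n IH] hP hv; first by rewrite expr0 mul1r.
have d0 : 0 <= c * r ^+ 2 by rewrite mulr_ge0// exprn_ge0// ltW.
apply: (le_trans (IH _ _)).
- by move=> k kn; apply: hP; rewrite ltnS ltnW.
- by move=> k kn; apply: hv; rewrite (leq_trans kn).
have k0 : 0 < 256 :> R by rewrite ltr0n.
rewrite [256 ^+ n.+1]exprSr -[leRHS]mulrA ler_pM2l; last exact: exprn_gt0.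
have [vL h] := hv n.+1 (leqnn _).
have := harnack_sq r0 c0 (hP n (ltnSn _)) vL (fun z Qz => (h z Qz).1)
  (fun z Qz => (h z Qz).2).
lra.
Qed.

Definition polar r t : R * R := (r * cos t, r * sin t).

Lemma enorm_polar r t : 0 <= r -> enorm (polar r t) = r.
Proof.
move=> r0; rewrite /enorm /=.
have -> : (r * cos t) ^+ 2 + (r * sin t) ^+ 2 = r ^+ 2.
  by rewrite !exprMn -mulrDr cos2Dsin2 mulr1.
by rewrite sqrtr_sqr ger0_norm.
Qed.

Lemma polar_exists z : exists2 t, `|t| <= pi & z = polar (enorm z) t.
Proof.
have [z0|z0] := eqVneq (enorm z) 0.
  exists 0; first by rewrite normr0 pi_ge0.
  have := sqr_enorm z; rewrite z0 expr0n /= => h.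
  have h1 : z.1 = 0 by apply/eqP; rewrite -sqrf_eq0; have := sqr_ge0 z.2; have := sqr_ge0 z.1; lra.
  have h2 : z.2 = 0 by apply/eqP; rewrite -sqrf_eq0; have := sqr_ge0 z.2; have := sqr_ge0 z.1; lra.
  by rewrite /polar !mul0r; case: z h1 h2 {z0 h} => /= ? ? -> ->.
have zp : 0 < enorm z by rewrite lt_def z0 enorm_ge0.
have c1 : -1 <= z.1 / enorm z <= 1.
  rewrite ler_pdivrMr// ler_pdivlMr// mulN1r mul1r.
  by have := normr1_enorm z; rewrite ler_norml.
have ac : cos (acos (z.1 / enorm z)) = z.1 / enorm z.
  by rewrite acosK// in_itv.
have as_ : sin (acos (z.1 / enorm z)) = `|z.2| / enorm z.
  rewrite sin_acos//.
  have -> : 1 - (z.1 / enorm z) ^+ 2 = (z.2 / enorm z) ^+ 2.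
    by have := sqr_enorm z => h; rewrite !exprMn !exprVn h; field; rewrite -h expf_neq0.
  by rewrite sqrtr_sqr normrM normfV (gtr0_norm zp).
have a0 := acos_ge0 c1; have api := acos_lepi c1.
case: (leP 0 z.2) => hz.
  exists (acos (z.1 / enorm z)); first by rewrite ger0_norm.
  rewrite /polar ac as_ (ger0_norm hz).
  by rewrite ![enorm z * _]mulrC !divfK//; case: z {hz z0 zp c1 ac as_ a0 api}.
exists (- acos (z.1 / enorm z)); first by rewrite normrN ger0_norm.
rewrite /polar cosN sinN ac as_ (ltr0_norm hz).
rewrite mulNr opprK.
by rewrite ![enorm z * _]mulrC !divfK//; case: z {hz z0 zp c1 ac as_ a0 api}.
Qed.

Lemma lipschitz1_MVT (f df : R -> R) : (forall s, is_derive s 1 f (df s)) ->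
  (forall s, `|df s| <= 1) -> forall a b, `|f a - f b| <= `|a - b|.
Proof.
move=> fd df1; suff S a b : a <= b -> `|f b - f a| <= `|b - a|.
  move=> a b; case: (leP a b) => ab; last by apply: S; exact: ltW.
  by rewrite distrC [leRHS]distrC; exact: S.
move=> ab.
have cf : {within `[a, b], continuous f}.
  apply: continuous_in_subspaceT => s _; exact: is_derive_continuous (fd s).
have [c _ ->] := @MVT_segment _ f df a b ab (fun s _ => fd s) cf.
by rewrite normrM ler_piMl.
Qed.

Lemma polar_sq r s t : 0 <= r -> sq (polar r t) (r * `|s - t|) (polar r s).
Proof.
move=> r0; split => /=; rewrite -mulrBr normrM ger0_norm//; apply: ler_wpM2l => //.
  have h w : `|- sin w| <= 1 :> R by rewrite normrN sin_max.
  exact: (lipschitz1_MVT (@is_derive_cos R) h).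
exact: (lipschitz1_MVT (@is_derive_sin R) (@cos_max R)).
Qed.

Definition annulus a b : set (R * R) := [set z | a < enorm z < b].

Theorem harnack_circle : exists2 C : R, 1 <= C &
  forall r c v L x y, 0 < r -> 0 <= c -> enorm x = r -> enorm y = r ->
  has_laplacian (annulus (r / 2) (2 * r)) v L ->
  (forall z, annulus (r / 2) (2 * r) z -> 0 <= v z /\ `|L z| <= c) ->
  v x <= C * (v y + c * r ^+ 2).
Proof.
(* Angles differ by at most [2 pi < 8], so each of [128] steps moves by at most [r / 16]. Squares of
   half-side [r / 4] about the points stay in the annulus because [3 / 2 * (r / 4) < r / 2]. *)
pose n := 128%N; exists (256 ^+ n) => [|r c v L x y r0 c0 xr yr vL h].
  by rewrite exprn_ege1//; lra.
have [s hs xE] := polar_exists x; have [t ht yE] := polar_exists y.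
rewrite xr in xE; rewrite yr in yE.
pose P k := polar r (s + k%:R / n%:R * (t - s)).
have r16 : 0 < r / 16 by lra.
have pi4 : pi < 4 :> R by have := @pihalf_lt2 R; lra.
have sub k z : sq (P k) (4 * (r / 16)) z -> annulus (r / 2) (2 * r) z.
  move=> /sq_enorm h1; have h2 := enorm_sub (P k) z; have h3 := enorm_sub z (P k).
  have h4 : enorm (P k) = r by rewrite enorm_polar// ltW.
  by rewrite enormB in h2; rewrite /annulus/=; lra.
have n0 : 0 < n%:R :> R by rewrite ltr0n.
have h1 k : (k < n)%N -> sq (P k.+1) (r / 16) (P k).
  move=> _; have := @polar_sq r (s + k%:R / n%:R * (t - s))
    (s + k.+1%:R / n%:R * (t - s)) (ltW r0).
  apply: sq_le.
  have -> : s + k%:R / n%:R * (t - s) - (s + k.+1%:R / n%:R * (t - s)) =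
      (s - t) / n%:R.
    by rewrite -natr1; field; rewrite gt_eqF.
  rewrite normrM normfV (gtr0_norm n0).
  apply: ler_wpM2l; first exact: ltW.
  rewrite ler_pdivrMr//; have h8 : `|s - t| <= 8 by have := ler_normB s t; lra.
  apply: (le_trans h8); rewrite /n; lra.
have h2 k : (k <= n)%N -> has_laplacian (sq (P k) (4 * (r / 16))) v L /\
    forall z, sq (P k) (4 * (r / 16)) z -> 0 <= v z /\ `|L z| <= c.
  move=> _; split; first by apply: has_laplacianS vL; exact: sub.
  by move=> z /sub/h.
have := harnack_chain r16 c0 h1 h2.
have -> : P 0%N = x by rewrite /P mul0r mul0r addr0.
have -> : P n = y by rewrite /P divff ?gt_eqF// mul1r addrC subrK.
have d0 : 0 <= c * r ^+ 2 by rewrite mulr_ge0// exprn_ge0// ltW.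
have -> : c * (r / 16) ^+ 2 = c * r ^+ 2 / 256 by field.
move=> H; apply: (@le_trans _ _ (v x + 5 * (c * r ^+ 2 / 256))); first lra.
have k0 : 0 < 256 :> R by rewrite ltr0n.
apply: (le_trans H); rewrite ler_pM2l; [lra|exact: exprn_gt0].
Qed.

End harnack.

(** * Small mass regularity *)

Section choi_schoen.
Context {R : realType}.
Implicit Types (x y z : R * R) (r s t a b c d M m : R) (u v L : R * R -> R).
Local Notation mu := (@lebesgue_measure R).
Local Notation mu2 := (mu \x mu)%E.

Lemma continuous_on_comp (A : set (R * R)) u (f : R -> R) :
  continuous f -> continuous_on A u -> continuous_on A (fun z => f (u z)).
Proof.
move=> cf cu z Az; apply: (@continuous_comp _ _ _ u f); first exact: cu.
exact: cf.
Qed.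

(** Jensen's inequality through the tangent of [expR] at [b = u x - c r^2 / 4], a lower bound for
    the weighted mean of [u]. Mass at least [2] and height at most [4 / r^2] of the weight give the
    factor [2]. *)
Lemma exp_mean_value x r c u L : 0 < r -> 0 <= c ->
  has_laplacian (sq x r) u L -> (forall z, sq x r z -> - c <= L z) ->
  r ^+ 2 * expR (u x) <=
  expR (c * r ^+ 2 / 4) * (2 * \int[mu2]_(z in sq x r) expR (u z)).
Proof.
move=> r0 c0 uL Lc; have r2 : 0 < r ^+ 2 by rewrite exprn_gt0.
have s1 : Num.sqrt (r ^+ 2) = r by rewrite sqrtr_sqr gtr0_norm.
have Q : sq x (Num.sqrt (r ^+ 2)) `<=` sq x r by rewrite s1.
have := mean_value_le r0 r2 c0 Q uL Lc.
have J2 := keta_integral_ge r2 Q.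
set J := \int[mu2]_(z in sq x r) keta (r ^+ 2) (N x z) in J2 *.
have cu := has_laplacian_continuous uL.
have ce : continuous_on (sq x r) (fun z => expR (u z)).
  by apply: continuous_on_comp => //; exact: continuous_expR.
have ck : continuous_on (sq x r) (fun z => keta (r ^+ 2) (N x z)).
  by move=> z _; exact: continuous_keta_N.
have kE : c * (r ^+ 2 / 4) = c * r ^+ 2 / 4 by field.
rewrite kE; set k := c * r ^+ 2 / 4; pose b := u x - k => mv.
have E1 : expR b * J <= \int[mu2]_(z in sq x r) (expR (u z) * keta (r ^+ 2) (N x z)).
  apply: (@le_trans _ _ (expR b * ((1 - b) * J +
     \int[mu2]_(z in sq x r) (u z * keta (r ^+ 2) (N x z))))).
    rewrite ler_pM2l ?expR_gt0//.
    by move: mv; set I := Rintegral _ _ _; rewrite /b; clearbody J I => mv; lra.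
  rewrite -sq_integralZ// -sq_integralD; last 2 first.
  - by apply: continuous_onM => //; exact: continuous_on_cst.
  - exact: continuous_onM.
  rewrite -sq_integralZ; last first.
    apply: continuous_onD; last exact: continuous_onM.
    by apply: continuous_onM => //; exact: continuous_on_cst.
  apply: sq_integral_le.
  - apply: continuous_onM; first exact: continuous_on_cst.
    apply: continuous_onD; last exact: continuous_onM.
    by apply: continuous_onM => //; exact: continuous_on_cst.
  - exact: continuous_onM.
  move=> z _; rewrite -mulrDl mulrA; apply: ler_wpM2r; first exact: keta_ge0.
  have -> : expR (u z) = expR b * expR (u z - b) by rewrite -expRD addrC subrK.
  rewrite ler_pM2l ?expR_gt0//.
  by have := expR_ge1Dx (u z - b); lra.
have E2 : \int[mu2]_(z in sq x r) (expR (u z) * keta (r ^+ 2) (N x z)) <=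
    4 / r ^+ 2 * \int[mu2]_(z in sq x r) expR (u z).
  rewrite -sq_integralZ//; apply: sq_integral_le.
  - exact: continuous_onM.
  - by apply: continuous_onM => //; exact: continuous_on_cst.
  move=> z _; rewrite mulrC; apply: ler_wpM2r; first exact: expR_ge0.
  by apply: keta_le => //; exact: N_ge0.
have E3 : expR b * 2 <= 4 / r ^+ 2 * \int[mu2]_(z in sq x r) expR (u z).
  by apply: le_trans E2; apply: le_trans E1; rewrite ler_pM2l ?expR_gt0.
have -> : expR (u x) = expR k * expR b by rewrite -expRD /b addrC subrK.
rewrite mulrCA ler_pM2l ?expR_gt0//.
move: E3; set I := Rintegral _ _ _ => E3.
have : r ^+ 2 * (expR b * 2) <= r ^+ 2 * (4 / r ^+ 2 * I) by rewrite ler_pM2l.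
have -> : r ^+ 2 * (4 / r ^+ 2 * I) = 4 * I by field; lra.
by clearbody J I k; lra.
Qed.

(* The Choi-Schoen trick: rescale around the maximum of
   [(d - |z - x|)^2 exp u], where [exp u] is almost maximal. *)
Lemma choi_schoen x d M m u L : 0 < d -> 0 < M ->
  has_laplacian (sq x d) u L ->
  (forall z, sq x d z -> - (M * expR (u z)) <= L z) ->
  \int[mu2]_(z in sq x d) expR (u z) <= m ->
  2 * expR M * m < 1 ->
  d ^+ 2 * expR (u x) <= 8 * expR M * m.
Proof.
move=> d0 M0 uL Lc Im m1; have cu := has_laplacian_continuous uL.
have ce : continuous_on (sq x d) (fun z => expR (u z)).
  by apply: continuous_on_comp => //; exact: continuous_expR.
pose n z := Num.max `|z.1 - x.1| `|z.2 - x.2|.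
have nP z s : n z <= s <-> sq x s z by rewrite /n ge_max; split => [/andP|[-> ->]].
have cn z : {for z, continuous n}.
  apply: continuous_max.
    by apply: (@continuous_comp _ _ _ (fun z => z.1 - x.1) (fun s => `|s|));
      [exact: continuous_B1|exact: norm_continuous].
  by apply: (@continuous_comp _ _ _ (fun z => z.2 - x.2) (fun s => `|s|));
      [exact: continuous_B2|exact: norm_continuous].
pose F z := (d - n z) ^+ 2 * expR (u z).
have Qx : sq x d x by split; rewrite subrr normr0 ltW.
have cF : {within sq x d, continuous F}.
  apply: continuous_in_subspaceT => z /set_mem Qz.
  apply: cvgM; last exact: ce.
  by apply: cvgM; (apply: cvgB; [exact: cvg_cst|exact: cn]).
have [z0 /set_mem Qz0 Fmax] := compact_EVT_max (ex_intro _ x Qx) (@compact_sq _ x d) cF.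
have nx : n x = 0 by rewrite /n !subrr normr0 maxxx.
have Fx : F x = d ^+ 2 * expR (u x) by rewrite /F nx subr0.
rewrite -Fx; have Fx0 : 0 < F x by rewrite Fx mulr_gt0 ?expR_gt0// exprn_gt0.
have Fxz : F x <= F z0 by apply: Fmax; exact/mem_set.
set l := expR (u z0); have l0 : 0 < l by exact: expR_gt0.
pose s := (d - n z0) / 2.
have nz0 : n z0 <= d by apply/nP.
have Fz0 : F z0 = 4 * s ^+ 2 * l by rewrite /F /s -/l; field.
have s0 : 0 < s.
  rewrite lt_def; apply/andP; split; last by rewrite /s; lra.
  by apply/eqP => s0; move: Fxz; rewrite Fz0 s0; nra.
have sub z : sq z0 s z -> n z <= d - s.
  move=> h; apply/nP; have /nP := lexx (n z0) => h0.
  by apply: sq_le (sq_trans h0 h); rewrite /s; lra.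
have sub' z : sq z0 s z -> sq x d z by move=> /sub h; apply/nP; lra.
have el z : sq z0 s z -> expR (u z) <= 4 * l.
  move=> Qz; have := Fmax z (mem_set (sub' _ Qz)); rewrite Fz0 /F.
  have h1 : s ^+ 2 <= (d - n z) ^+ 2 by have := sub _ Qz; nra.
  have s2 : 0 < s ^+ 2 by rewrite exprn_gt0.
  move=> h; have ez := expR_gt0 (u z).
  rewrite -(ler_pM2l s2); apply: (@le_trans _ _ ((d - n z) ^+ 2 * expR (u z))).
    by rewrite ler_pM2r.
  by apply: (le_trans h); lra.
have key r : 0 < r -> r <= s -> r ^+ 2 * l <= expR (M * l * r ^+ 2) * (2 * m).
  move=> r0 rs.
  have sr z : sq z0 r z -> sq z0 s z by exact: sq_le.
  have c0 : 0 <= 4 * M * l by rewrite !mulr_ge0// ltW.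
  have Q : sq z0 r `<=` sq x d by move=> z /sr/sub'.
  have Lc' z : sq z0 r z -> - (4 * M * l) <= L z.
    move=> h; have := Lc _ (Q _ h); have := el _ (sr _ h); nra.
  have := exp_mean_value r0 c0 (has_laplacianS Q uL) Lc'; rewrite -/l.
  have -> : 4 * M * l * r ^+ 2 / 4 = M * l * r ^+ 2 by field.
  move=> /le_trans; apply; rewrite ler_pM2l ?expR_gt0// ler_pM2l//.
  apply: le_trans Im; apply: sq_integral_subset => // z _; exact: expR_ge0.
have m0 : 0 <= m.
  by apply: le_trans Im; apply: Rintegral_ge0 => z _; exact: expR_ge0.
(* If [s^2 l <= 1], the radius [s] in [key] gives the claim. Otherwise [r = l^(-1/2)] fits below
   [s], and [key] yields [1 <= 2 exp(M) m], which the smallness of [m] excludes. *)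
have [h|h] := leP (s ^+ 2 * l) 1.
  apply: (le_trans Fxz); rewrite Fz0.
  have hm : M * l * s ^+ 2 <= M by nra.
  have : expR (M * l * s ^+ 2) <= expR M by rewrite ler_expR.
  have := key s s0 (lexx _); nra.
have sl : 0 < Num.sqrt l by rewrite sqrtr_gt0.
have sl2 : Num.sqrt l ^+ 2 = l by rewrite sqr_sqrtr// ltW.
have r0 : 0 < (Num.sqrt l)^-1 by rewrite invr_gt0.
have rE : (Num.sqrt l)^-1 ^+ 2 = l^-1 by rewrite exprVn sl2.
have rs : (Num.sqrt l)^-1 <= s.
  rewrite -ler_sqr ?nnegrE ?(ltW r0) ?(ltW s0)// rE -[leLHS]mul1r ler_pdivrMr//.
  exact: ltW.
have := key _ r0 rs; rewrite rE mulVf ?gt_eqF// mulfK ?gt_eqF//; lra.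
Qed.

Lemma measurable_pdisc r :
  measurable (pdisc r : set (measurableTypeR R * measurableTypeR R)).
Proof.
have ce : continuous_on setT (fun z : R * R => enorm z).
  move=> z _; apply: (@continuous_comp _ _ _ (fun z => z.1 ^+ 2 + z.2 ^+ 2) Num.sqrt).
    apply: cvgD; first by apply: cvgM; exact: continuous_fst.
    by apply: cvgM; exact: continuous_snd.
  exact: sqrt_continuous.
have mT : measurable ([set: R * R] : set (measurableTypeR R * measurableTypeR R)).
  exact: measurableT.
have := continuous_on_measurable mT ce mT (measurable_itv `]0, r[).
by rewrite setTI; congr measurable; apply/seteqP; split => z /=; rewrite in_itv.
Qed.

(** Dominated convergence along the radii [1 / (n + 1)]: every point of the punctured disc
    eventually leaves the shrinking discs. *)
Lemma integral_pdisc_cvg0 u : continuous_on (pdisc 1) u ->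
  (\int[mu2]_(x in pdisc 1) (expR (u x))%:E < +oo)%E ->
  forall e, 0 < e -> exists2 r, 0 < r <= 1 &
    (\int[mu2]_(x in pdisc r) (expR (u x))%:E <= e%:E)%E.
Proof.
move=> cu ui e e0.
have ce : continuous_on (pdisc 1) (fun z => expR (u z)).
  by apply: continuous_on_comp => //; exact: continuous_expR.
have mD := @measurable_pdisc 1.
have me : measurable_fun (pdisc 1 : set (measurableTypeR R * measurableTypeR R))
   (fun z => (expR (u z))%:E).
  by apply/measurable_EFinP; exact: continuous_on_measurable.
pose f n := (fun z => (expR (u z))%:E) \_ (pdisc n.+1%:R^-1).
have ig : mu2.-integrable (pdisc 1) (fun z => (expR (u z))%:E).
  apply/integrableP; split => //.
  by under eq_integral do rewrite gee0_abs ?lee_fin ?expR_ge0//.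
have sub n : pdisc n.+1%:R^-1 `<=` (pdisc 1 : set (R * R)).
  move=> z /andP[z0 zn]; rewrite /pdisc/= z0 (lt_le_trans zn)//.
  by rewrite invf_le1// ?ler1n ?ltr0n.
have := @dominated_cvg _ _ _ mu2 (pdisc 1) mD f (cst 0%E)
  (fun z => (expR (u z))%:E).
have fE n : (\int[mu2]_(x in pdisc 1) f n x =
   \int[mu2]_(x in pdisc n.+1%:R^-1) (expR (u x))%:E)%E.
  rewrite -integral_mkcondr; congr integral.
  by apply/seteqP; split => z; [case|move=> h; split => //; exact: (sub n)].
rewrite integral_cst//= mul0e => H.
have /fine_cvgP[_ /cvgrPdist_le/(_ _ e0)[n _ /(_ n (leqnn n))]] :
  (\int[mu2]_(x in pdisc 1) f n x)%E @[n --> \oo] --> 0%:E.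
  apply: H => //.
  - move=> n; apply/(measurable_restrict _ (@measurable_pdisc _) mD).
    by apply: measurable_funS me => //; exact: subIsetl.
  - move=> z /andP[z0 z1]; apply: cvg_near_cst.
    have [n nz] : exists n : nat, n.+1%:R^-1 < enorm z.
      have [n] := ltr_add_invr z0; rewrite add0r => hn; by exists n.
    exists n => // k /= nk; rewrite /f patchE ifF//.
    apply/negbTE/negP => /set_mem /andP[_ zk].
    have : k.+1%:R^-1 <= n.+1%:R^-1 :> R by rewrite lef_pV2 ?posrE ?ltr0n// ler_nat.
    by move=> hk; have := lt_trans nz (lt_le_trans zk hk); rewrite ltxx.
  - move=> n z _; rewrite /f patchE; case: ifPn => _.
      by rewrite gee0_abs// lee_fin expR_ge0.
    by rewrite abse0 lee_fin expR_ge0.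
rewrite /= fE sub0r normrN => h; exists n.+1%:R^-1.
  by rewrite invr_gt0 ltr0n invf_le1// ?ler1n ?ltr0n.
rewrite -[leLHS]fineK.
  by rewrite lee_fin (le_trans (ler_norm _)).
rewrite ge0_fin_numE; last by apply: integral_ge0 => z _; rewrite lee_fin expR_ge0.
apply: le_lt_trans ui; apply: ge0_subset_integral => //.
- exact: measurable_pdisc.
Qed.

End choi_schoen.

(** * Pointwise bounds from the hypotheses on [K] and [u] *)

Section data.
Context {R : realType}.
Implicit Types (x y z : R * R) (r s t a b c d M m : R) (u v L K : R * R -> R).
Local Notation mu := (@lebesgue_measure R).
Local Notation mu2 := (mu \x mu)%E.

Lemma is_derive_slice1 u z : derivable u z (@e1 R) ->
  is_derive z.1 1 (fun h => u (h, z.2)) (pd u (@e1 R) z).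
Proof.
have E : (fun h : R => h^-1 *: (((fun h => u (h, z.2)) \o shift z.1) (h *: 1) - u z)) =
         (fun h : R => h^-1 *: ((u \o shift z) (h *: (@e1 R)) - u z)).
  apply/funext => h; congr (_ *: (u _ - _)); case: z => z1 z2 /=.
  congr (_, _); rewrite /e1 /= -[h *: 0]/(h * 0) mulr0 add0r //.
case: z E => z1 z2 E du; split.
  by rewrite /derivable E.
by rewrite /pd /derive E.
Qed.

Lemma is_derive_slice2 u z : derivable u z (@e2 R) ->
  is_derive z.2 1 (fun h => u (z.1, h)) (pd u (@e2 R) z).
Proof.
have E : (fun h : R => h^-1 *: (((fun h => u (z.1, h)) \o shift z.2) (h *: 1) - u z)) =
         (fun h : R => h^-1 *: ((u \o shift z) (h *: (@e2 R)) - u z)).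
  apply/funext => h; congr (_ *: (u _ - _)); case: z => z1 z2 /=.
  congr (_, _); rewrite /e2 /= -[h *: 0]/(h * 0) mulr0 add0r //.
case: z E => z1 z2 E du; split.
  by rewrite /derivable E.
by rewrite /pd /derive E.
Qed.

Lemma C2_has_laplacian U u : C2_on U u -> has_laplacian U u (laplacian u).
Proof.
move=> H; exists (pd u (@e1 R)), (pd u (@e2 R)), (pd (pd u (@e1 R)) (@e1 R)),
  (pd (pd u (@e2 R)) (@e2 R)) => z /H[cu h].
have [d1 [c1 h1]] := h _ (or_introl erefl).
have [d11 c11] := h1 _ (or_introl erefl).
have [d2 [c2 h2]] := h _ (or_intror erefl).
have [d22 c22] := h2 _ (or_intror erefl).
split; last by rewrite /laplacian.
split; split; [exact cu|exact c11|exact c22|exact (is_derive_slice1 d1)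
  |exact (is_derive_slice1 d11)|exact (is_derive_slice2 d2)
  |exact (is_derive_slice2 d22)].
Qed.

Lemma continuous_enorm z : {for z, continuous (@enorm R)}.
Proof.
apply: (@continuous_comp _ _ _ (fun z => z.1 ^+ 2 + z.2 ^+ 2) Num.sqrt).
  apply: cvgD; first by apply: cvgM; exact: continuous_fst.
  by apply: cvgM; exact: continuous_snd.
exact: sqrt_continuous.
Qed.

Lemma near_annulus a b z : a < enorm z < b ->
  \forall w \near z, a < enorm w < b.
Proof.
move=> /andP[za zb].
have h1 := cvgr_gt (enorm z) (@continuous_enorm z) _ za.
have h2 := cvgr_lt (enorm z) (@continuous_enorm z) _ zb.
near=> w; apply/andP; split; near: w; [exact: h1|exact: h2].
Unshelve. all: by end_near. Qed.

(** A null set cannot cover a square, whose area is positive. This turns almost-everywhere bounds on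
    [K] into pointwise ones for the continuous function equal to it. *)
Lemma ae_sq (P : R * R -> Prop) z e : 0 < e ->
  (\forall x \ae (@leb2 R), P x) -> exists2 w, sq z e w & P w.
Proof.
move=> e0 [A [mA A0 PA]]; apply: contrapT => H.
have QA : sq z e `<=` A.
  by move=> w Qw; apply: PA => Pw; apply: H; exists w.
have A0' : mu2 A = 0%E := A0.
have : (mu2 (sq z e) <= mu2 A)%E.
  by apply: le_measure => //; rewrite inE//; exact: measurable_sq.
rewrite A0' (measure_sq z (ltW e0)) lee_fin.
by have := exprn_gt0 2 e0; nra.
Qed.

Lemma curvature_bounds K u
  (K_ess_bdd : exists M : R, (\forall x \ae (@leb2 R), disc 1 x -> `|K x| <= M))
  (K_nonneg : (\forall x \ae (@leb2 R), disc 1 x -> 0 <= K x))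
  (u_C2 : C2_on (pdisc 1) u)
  (u_eq : forall x, pdisc 1 x -> - laplacian u x = K x * expR (u x)) :
  exists2 M, 0 < M &
    forall z, pdisc 1 z -> - (M * expR (u z)) <= laplacian u z <= 0.
Proof.
have [M0 hM0] := K_ess_bdd; pose M := Num.max 1 M0.
have M1 : 1 <= M by rewrite le_max lexx.
have MM : M0 <= M by rewrite le_max lexx orbT.
exists M => [|z0 Uz0]; first lra.
pose g z := - laplacian u z * expR (- u z).
have gK z : pdisc 1 z -> g z = K z.
  by move=> Uz; rewrite /g u_eq// -mulrA -expRD subrr expR0 mulr1.
have cg : {for z0, continuous g}.
  have [cu h] := u_C2 _ Uz0.
  have [d1 [c1 h1]] := h _ (or_introl erefl).
  have [d11 c11] := h1 _ (or_introl erefl).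
  have [d2 [c2 h2]] := h _ (or_intror erefl).
  have [d22 c22] := h2 _ (or_intror erefl).
  have cl : {for z0, continuous (fun z => - laplacian u z)}.
    exact: cvgN (cvgD c11 c22).
  have ce : {for z0, continuous (fun z => expR (- u z))}.
    apply: (@continuous_comp _ _ _ (fun z => - u z) expR); first exact: cvgN cu.
    exact: continuous_expR.
  exact: cvgM cl ce.
have nU : \forall z \near z0, pdisc 1 z by exact: near_annulus.
have subd z : pdisc 1 z -> disc 1 z by move=> /andP[].
have gP : 0 <= g z0 <= M.
  rewrite !leNgt; apply/andP; split; apply/negP => hg.
    have : \forall z \near z0, pdisc 1 z /\ g z < 0.
      by near=> z; split; near: z; [exact: nU|exact: (cvgr_lt (g z0) cg _ hg)].
    move=> /near_sq[e e0 he]; have [w /he[Uw gw] Pw] := ae_sq z0 e0 K_nonneg.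
    by have := Pw (subd _ Uw); rewrite -gK//; lra.
  have : \forall z \near z0, pdisc 1 z /\ M < g z.
    by near=> z; split; near: z; [exact: nU|exact: (cvgr_gt (g z0) cg _ hg)].
  move=> /near_sq[e e0 he]; have [w /he[Uw gw] Pw] := ae_sq z0 e0 hM0.
  by have := Pw (subd _ Uw); rewrite -gK// ler_norml; lra.
have := u_eq _ Uz0; rewrite -gK//; have := expR_gt0 (u z0); nra.
Unshelve. all: by end_near. Qed.

Lemma sq_sub_pdisc x r : 0 < enorm x -> r <= enorm x / 4 ->
  sq x r `<=` pdisc (2 * enorm x).
Proof.
move=> x0 hr z /sq_enorm h.
have h1 := enorm_sub x z; have h2 := enorm_sub z x; rewrite enormB in h1.
by rewrite /pdisc/=; lra.
Qed.

Lemma singular_decay u L M : 0 < M -> has_laplacian (pdisc 1) u L ->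
  (forall z, pdisc 1 z -> - (M * expR (u z)) <= L z) ->
  (\int[@leb2 R]_(x in pdisc 1) (expR (u x))%:E < +oo)%E ->
  forall e, 0 < e -> exists2 d, 0 < d < 1 &
    forall x, 0 < enorm x < d -> enorm x ^+ 2 * expR (u x) <= e.
Proof.
move=> M0 uL Lc ui e e0; have cu := has_laplacian_continuous uL.
have eM := expR_gt0 M.
(* With [d = |x| / 4], [choi_schoen] bounds [|x|^2 exp u = 16 d^2 exp u] by [128 exp(M) m]; the
   second entry makes [2 exp(M) m] at most [1 / 2]. *)
pose m := Num.min (e / (128 * expR M)) (4 * expR M)^-1.
have m0 : 0 < m.
  by rewrite lt_min; apply/andP; split; rewrite ?divr_gt0 ?invr_gt0 ?mulr_gt0.
have [r /andP[r0 r1] hr] := integral_pdisc_cvg0 cu ui m0.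
exists (r / 2) => [|x /andP[x0 xr]]; first lra.
pose d := enorm x / 4; have d0 : 0 < d by rewrite /d; lra.
have Q : sq x d `<=` pdisc r.
  move=> z /(sq_sub_pdisc x0 (lexx _)); rewrite /pdisc/=; lra.
have Q1 : sq x d `<=` pdisc 1 by move=> z /Q; rewrite /pdisc/=; lra.
have ce : continuous_on (pdisc 1) (fun z => expR (u z)).
  by apply: continuous_on_comp => //; exact: continuous_expR.
have Im : \int[mu2]_(z in sq x d) expR (u z) <= m.
  have ie : mu2.-integrable (sq x d) (EFin \o (fun z => expR (u z))).
    by apply: continuous_on_integrable => z /Q1; exact: ce.
  have fin := integrable_fin_num (measurable_sq x d) ie.
  rewrite -lee_fin /Rintegral fineK//.
  apply: le_trans hr; apply: ge0_subset_integral => //.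
  - exact: measurable_sq.
  - exact: measurable_pdisc.
  - apply/measurable_EFinP; apply: continuous_on_measurable.
      exact: measurable_pdisc.
    move=> z Uz; apply: ce; move: Uz; rewrite /pdisc/=; lra.
have m1 : 2 * expR M * m < 1.
  have : m <= (4 * expR M)^-1 by rewrite ge_min lexx orbT.
  move=> h; apply: (@le_lt_trans _ _ (2 * expR M * (4 * expR M)^-1)).
    by rewrite ler_pM2l// mulr_gt0.
  have -> : 2 * expR M * (4 * expR M)^-1 = 1 / 2 by field; lra.
  lra.
have := choi_schoen d0 M0 (has_laplacianS Q1 uL) (fun z Qz => Lc _ (Q1 _ Qz)) Im m1.
have : m <= e / (128 * expR M) by rewrite ge_min lexx.
rewrite ler_pdivlMr ?mulr_gt0// /d => h1 h2.
have -> : enorm x ^+ 2 = 16 * (enorm x / 4) ^+ 2 by field.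
rewrite -mulrA; lra.
Qed.

End data.

(** * Comparison on annuli *)

Section comparison.
Context {R : realType}.
Implicit Types (x y z : R * R) (r s t a b c d M m : R) (u v L : R * R -> R).

(** Otherwise [dg], zero at [s], is positive just to the right of [s], and the mean value theorem
    lifts [g] above its maximum. *)
Lemma second_derivative_max (g dg : R -> R) s d D : 0 < d ->
  (forall t, `|t - s| < d -> is_derive t 1 g (dg t)) ->
  is_derive s 1 dg D -> (forall t, `|t - s| < d -> g t <= g s) -> D <= 0.
Proof.
move=> d0 hg hdg gmax.
have itv t : t \in `]s - d, s + d[ = (`|t - s| < d) by rewrite in_itv/= ltr_distl.
have ss : `|s - s| < d by rewrite subrr normr0.
have dg0 : dg s = 0.
  have h0 : is_derive s 1 g 0.
    apply: (@derive1_at_max _ g (s - d) (s + d)).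
    - lra.
    - by move=> t; rewrite itv => /hg h; exact: (@ex_derive _ _ _ _ _ _ _ h).
    - by rewrite itv.
    - by move=> t; rewrite itv; exact: gmax.
  by rewrite -(@derive_val _ _ _ _ _ _ _ (hg s ss)) (@derive_val _ _ _ _ _ _ _ h0).
rewrite leNgt; apply/negP => D0.
have D2 : 0 < D / 2 by lra.
have [e e0 he] := (is_derive_eps dg s D).1 hdg _ D2.
pose h := Num.min (e / 2) (d / 2).
have h0 : 0 < h by rewrite lt_min; lra.
have h1 : h <= e / 2 by rewrite ge_min lexx.
have h2 : h <= d / 2 by rewrite ge_min lexx orbT.
have dgp t : s < t < s + h -> is_derive t 1 g (dg t).
  by move=> ht; apply: hg; rewrite ltr_distl; lra.
have cg : {within `[s, s + h], continuous g}.
  apply: continuous_in_subspaceT => t /set_mem /=; rewrite in_itv/= => ht.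
  have /hg : `|t - s| < d by rewrite ltr_distl; lra.
  exact: is_derive_continuous.
have sh : s < s + h by lra.
have dgi t : t \in `]s, s + h[ -> is_derive t 1 g (dg t).
  by rewrite in_itv/=; exact: dgp.
have [c] := MVT sh dgi cg.
rewrite in_itv/= => /andP[c1 c2].
have gs : g (s + h) <= g s by apply: gmax; rewrite addrAC subrr add0r gtr0_norm//; lra.
have := he (c - s); rewrite gtr0_norm ?subr_gt0// => /(_ ltac:(lra)).
rewrite [s + (c - s)]addrC subrK dg0 subr0 ler_distl => /andP[hc _] E.
have Dc : 0 < D * (c - s) by rewrite mulr_gt0//; lra.
have dgc : 0 < dg c by lra.
have : 0 < dg c * (s + h - s) by rewrite mulr_gt0//; lra.
lra.
Qed.

Lemma compact_annulus a b :
  compact [set z : R * R | a <= enorm z <= b].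
Proof.
have -> : [set z : R * R | a <= enorm z <= b] =
   sq 0 b `&` (@enorm R) @^-1` `[a, b]%classic.
  apply/seteqP; split => z /=; rewrite in_itv/=.
    by move=> h; split => //; apply: enorm_sq; rewrite subr0; lra.
  by case.
apply: compact_closedI; first exact: compact_sq.
apply: preimage_closed => [z _|]; first exact: continuous_enorm.
exact: interval_closed.
Qed.

Lemma has_laplacian_sqr U : has_laplacian U (N (0 : R * R)) (fun=> 4).
Proof.
apply: (@has_laplacian_eq _ _ _ (fun z => 4 * 1 + 4 * N 0 z * 0)).
  by move=> z _; ring.
apply: (@has_laplacian_radial _ _ _ id (fun=> 1) (fun=> 0)) => z _.
by split; [exact: is_derive_id|exact: is_derive_cstE|exact: cvg_cst].
Qed.

Lemma N0E z : N 0 z = enorm z ^+ 2.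
Proof. by rewrite sqr_enorm /N /= !subr0. Qed.

(** Adding [e |z|^2] makes the Laplacian strictly positive, which no interior maximum allows. With
    [e = v z1 / (2 b^2)] the perturbation is at most half of the supposed positive value, so the
    maximum cannot sit on the boundary either. *)
Theorem max_principle U a b v L : 0 < a ->
  [set z | a <= enorm z <= b] `<=` U -> has_laplacian U v L ->
  (forall z, a <= enorm z <= b -> 0 <= L z) ->
  (forall z, enorm z = a \/ enorm z = b -> v z <= 0) ->
  forall z, a <= enorm z <= b -> v z <= 0.
Proof.
move=> a0 AU vL Lp vb z1 Az1; rewrite leNgt; apply/negP => vz1.
have b0 : 0 < b by lra.
pose e := v z1 / (2 * b ^+ 2).
have b2 : 0 < b ^+ 2 by rewrite exprn_gt0.
have e0 : 0 < e by rewrite divr_gt0// mulr_gt0.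
have eb : e * b ^+ 2 = v z1 / 2 by rewrite /e; field; lra.
have WL := has_laplacianD vL (has_laplacianZ e (has_laplacian_sqr U)).
set W := (fun z => v z + _) in WL.
have cW : {within [set z | a <= enorm z <= b], continuous W}.
  apply: continuous_in_subspaceT => z /set_mem /AU Uz.
  exact: (has_laplacian_continuous WL).
have [z0 /set_mem Az0 Wmax] := compact_EVT_max (ex_intro _ z1 Az1)
  (@compact_annulus a b) cW.
have W1 : v z1 <= W z0.
  apply: (@le_trans _ _ (W z1)); last by apply: Wmax; exact/mem_set.
  by rewrite /W N0E; have := sqr_ge0 (enorm z1); nra.
have W0 : W z0 <= v z0 + v z1 / 2.
  have /andP[_ zb] := Az0.
  by rewrite /W N0E -eb lerD2l ler_pM2l// ler_sqr ?nnegrE ?enorm_ge0 ?(ltW b0).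
have int : a < enorm z0 < b.
  have [/vb h|h1] := pselect (enorm z0 = a \/ enorm z0 = b); first lra.
  have /andP[az zb] : a <= enorm z0 <= b by [].
  rewrite !lt_def az zb !andbT; apply/andP; split; apply/eqP => h; apply: h1; auto.
have /near_sq[d d0 hd] := near_annulus int.
have [wx [wy [wxx [wyy H]]]] := WL.
have hA z : sq z0 d z -> [set z | a <= enorm z <= b] z.
  by move=> /hd/=; lra.
have [_ HL] := H z0 (AU _ Az0).
have := Lp _ Az0.
have : wxx z0 <= 0.
  apply: (@second_derivative_max (fun h => W (h, z0.2)) (fun h => wx (h, z0.2)) z0.1 d) => //.
  - move=> t ht; have : sq z0 d (t, z0.2) by split => /=; [exact: ltW|rewrite subrr normr0 ltW].
    by move=> /hA/AU/H[[_ []]].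
  - by have [[_ []]] := H z0 (AU _ Az0).
  - move=> t ht; have : sq z0 d (t, z0.2) by split => /=; [exact: ltW|rewrite subrr normr0 ltW].
    move=> /hA/mem_set/Wmax; by case: (z0).
have : wyy z0 <= 0.
  apply: (@second_derivative_max (fun h => W (z0.1, h)) (fun h => wy (z0.1, h)) z0.2 d) => //.
  - move=> t ht; have : sq z0 d (z0.1, t) by split => /=; [rewrite subrr normr0 ltW|exact: ltW].
    by move=> /hA/AU/H[[_ []]].
  - by have [[_ []]] := H z0 (AU _ Az0).
  - move=> t ht; have : sq z0 d (z0.1, t) by split => /=; [rewrite subrr normr0 ltW|exact: ltW].
    move=> /hA/mem_set/Wmax; by case: (z0).
lra.
Qed.

(** This is [ln |z|] off the origin, written through [N] so as to be a radial profile. *)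
Definition lnorm z : R := ln (N 0 z) / 2.

Lemma lnormE z : 0 < enorm z -> lnorm z = ln (enorm z).
Proof. by move=> z0; rewrite /lnorm N0E lnXn// -mulr_natr; field. Qed.

Lemma expR_lnorm z : 0 < enorm z -> expR (lnorm z) = enorm z.
Proof. by move=> z0; rewrite lnormE// lnK. Qed.

Lemma lnorm_expR z t : enorm z = expR t -> lnorm z = t.
Proof. by move=> zt; rewrite lnormE zt ?expR_gt0// expRK. Qed.

Lemma N0_gt0 z : 0 < enorm z -> 0 < N 0 z.
Proof. by move=> z0; rewrite N0E exprn_gt0. Qed.

Lemma is_deriveVE s : s != 0 -> is_derive s 1 (fun s : R => s^-1) (- (s ^- 2)).
Proof.
move=> s0; apply: is_derive_eq (@is_deriveV _ id _ _ _ s0 (is_derive_id _ _)) _.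
by rewrite -[_ *: _]/(_ * _) mulr1.
Qed.

Lemma continuous_V s : s != 0 -> {for s, continuous (fun s : R => s^-1)}.
Proof. by move=> s0; exact: is_derive_continuous (is_deriveVE s0). Qed.

Lemma has_laplacian_lnorm U : (forall z, U z -> 0 < enorm z) ->
  has_laplacian U lnorm (fun=> 0).
Proof.
move=> U0.
apply: (@has_laplacian_eq _ _ _ (fun z => 4 * ((N 0 z)^-1 * 2^-1) +
  4 * N 0 z * (- ((N 0 z) ^- 2) * 2^-1))).
  by move=> z /U0/N0_gt0 n0; field; rewrite gt_eqF.
apply: (@has_laplacian_radial _ _ _ (fun s => ln s / 2) (fun s => s^-1 * 2^-1)
  (fun s => - (s ^- 2) * 2^-1)) => z /U0/N0_gt0 n0.
have n0' : N 0 z != 0 by rewrite gt_eqF.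
split.
- by apply: is_derive_eq (is_deriveME (is_derive_lnE n0) (is_derive_cstE _ _)) _; ring.
- by apply: is_derive_eq (is_deriveME (is_deriveVE n0') (is_derive_cstE _ _)) _; ring.
- apply: cvgM; last exact: cvg_cst.
  apply: cvgN; apply: cvgV; first by rewrite expf_neq0.
  by apply: cvgM; exact: cvg_id.
Qed.

(** The function is [|z|^k]; for a small positive [k], a multiple of it will absorb the negative
    Laplacian of [u]. *)
Lemma has_laplacian_exp_lnorm U k : (forall z, U z -> 0 < enorm z) ->
  has_laplacian U (fun z => expR (k * lnorm z))
    (fun z => k ^+ 2 * expR (k * lnorm z) / enorm z ^+ 2).
Proof.
move=> U0; pose j := k / 2; pose p s := expR (j * ln s) : R.
have -> : (fun z => expR (k * lnorm z)) = (fun z => p (N 0 z)).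
  by apply/funext => z; rewrite /p /lnorm /j; congr expR; field.
have dp s : 0 < s -> is_derive s 1 p (p s * (j * s^-1)).
  move=> s0.
  exact: is_derive_compE (is_derive_expR _) (is_deriveZE j (is_derive_lnE s0)).
apply: (@has_laplacian_eq _ _ _ (fun z => 4 * (p (N 0 z) * (j * (N 0 z)^-1)) +
  4 * N 0 z * (p (N 0 z) * (j * (N 0 z)^-1) * (j * (N 0 z)^-1) +
               p (N 0 z) * (j * (- ((N 0 z) ^- 2)))))).
  move=> z /U0/N0_gt0 n0; rewrite -N0E.
  have -> : k = 2 * j by rewrite /j; field.
  have -> : expR (2 * j * lnorm z) = p (N 0 z).
    by rewrite /p /lnorm; congr expR; field.
  by field; rewrite gt_eqF.
apply: (@has_laplacian_radial _ _ _ p (fun s => p s * (j * s^-1))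
  (fun s => p s * (j * s^-1) * (j * s^-1) + p s * (j * (- (s ^- 2))))).
move=> z /U0/N0_gt0 n0.
have n0' : N 0 z != 0 by rewrite gt_eqF.
have cp : {for N 0 z, continuous p} := is_derive_continuous (dp _ n0).
have cV : {for N 0 z, continuous (fun s => j * s^-1)}.
  by apply: cvgM; [exact: cvg_cst|exact: continuous_V].
split; first exact: dp.
- apply: is_deriveME; first exact: dp.
  by apply: is_deriveZE; exact: is_deriveVE.
- apply: cvgD; first by apply: cvgM => //; apply: cvgM.
  apply: cvgM => //; apply: cvgM; first exact: cvg_cst.
  apply: cvgN; apply: cvgV; first by rewrite expf_neq0.
  by apply: cvgM; exact: cvg_id.
Qed.

(** The parameter [t] is the logarithm of the radius, in which radial harmonic functions are
    affine. *)
Definition circle_max v (T : R) (F : R -> R) := forall t, t < T ->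
  (exists2 z, enorm z = expR t & v z = F t) /\
  (forall z, enorm z = expR t -> v z <= F t).

Definition convex_below (T : R) (F : R -> R) := forall a b s,
  a < T -> b < T -> 0 <= s <= 1 ->
  F (s * a + (1 - s) * b) <= s * F a + (1 - s) * F b.

Lemma circle_max_exists v T : continuous_on (pdisc (expR T)) v ->
  exists F, circle_max v T F.
Proof.
move=> cv.
have H t : exists z, t < T -> enorm z = expR t /\
    forall w, enorm w = expR t -> v w <= v z.
  have [tT|tT] := pselect (t < T); last by exists 0.
  have ne : [set z : R * R | expR t <= enorm z <= expR t] !=set0.
    by exists (polar (expR t) 0) => /=; rewrite enorm_polar ?expR_ge0// lexx.
  have cv' : {within [set z | expR t <= enorm z <= expR t], continuous v}.
    apply: continuous_in_subspaceT => z /set_mem/= h; apply: cv.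
    have e0 := expR_gt0 t; have eT : expR t < expR T by rewrite ltr_expR.
    by rewrite /pdisc/=; lra.
  have [z /set_mem/= h hz] := compact_EVT_max ne (@compact_annulus _ _) cv'.
  exists z => _; split; first lra.
  by move=> w hw; apply: hz; apply/mem_set => /=; rewrite hw lexx.
have [f hf] := choice H.
exists (fun t => v (f t)) => t tT; have [h1 h2] := hf t tT.
by split => //; exists (f t).
Qed.

(** Hadamard's three circles theorem: the maximum principle for [v] minus the affine function of
    [lnorm] that interpolates [F] at [a] and [b]. *)
Lemma circle_max_convex v L T F : has_laplacian (pdisc (expR T)) v L ->
  (forall z, pdisc (expR T) z -> 0 <= L z) ->
  circle_max v T F -> convex_below T F.
Proof.
move=> vL L0 hF.
suff S a b s : a < b -> b < T -> 0 <= s <= 1 ->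
    F (s * a + (1 - s) * b) <= s * F a + (1 - s) * F b.
  move=> a b s aT bT s01; have [ab|ab|ab] := ltgtP a b; first exact: S.
  - have -> : s * a + (1 - s) * b = (1 - s) * b + (1 - (1 - s)) * a by ring.
    have -> : s * F a + (1 - s) * F b = (1 - s) * F b + (1 - (1 - s)) * F a by ring.
    by apply: S => //; lra.
  - have -> : s * a + (1 - s) * b = b by rewrite ab; ring.
    by rewrite ab; lra.
move=> ab bT s01; set t := s * a + (1 - s) * b.
have at_ : a <= t by rewrite /t; nra.
have tb : t <= b by rewrite /t; nra.
have [[z zt <-] _] := hF t ltac:(lra).
pose A := (F b - F a) / (b - a).
have Ab : A * (b - a) = F b - F a by rewrite /A divfK//; lra.
have U0 z' : pdisc (expR T) z' -> 0 < enorm z' by move=> /andP[].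
have wL := has_laplacianD vL (has_laplacianD
   (has_laplacianZ (- A) (has_laplacian_lnorm U0))
   (has_laplacian_cst (pdisc (expR T)) (A * a - F a))).
set w := (fun z => v z + _) in wL.
have e0 := expR_gt0 a; have eT : expR b < expR T by rewrite ltr_expR.
have : w z <= 0.
  apply: (max_principle (expR_gt0 a) _ wL (b := expR b)).
  - by move=> z'; rewrite /pdisc/=; lra.
  - move=> z' hz'; rewrite mulr0 addr0 addr0; apply: L0; rewrite /pdisc/=; move: hz'; lra.
  - move=> z' [] hz'; rewrite /w (lnorm_expR hz').
      by have := (hF a ltac:(lra)).2 z' hz'; lra.
    by have := (hF b bT).2 z' hz'; lra.
  - by rewrite zt !ler_expR at_.
rewrite /w (lnorm_expR zt) => h.
have e : A * (t - a) = (1 - s) * (F b - F a) by rewrite -Ab /t; ring.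
lra.
Qed.

End comparison.

(** * Convex functions on a half-line *)

Section convexity.
Context {R : realType}.
Implicit Types (r s t a b c d T : R) (F G D : R -> R).

(** To the left of a chord, a convex function lies above the extended chord; this supplies the
    linear lower bounds towards [-oo]. *)
Lemma convex_below_line T F t t0 t1 : convex_below T F ->
  t <= t0 -> t0 < t1 -> t1 < T ->
  F t0 + (F t0 - F t1) / (t1 - t0) * (t0 - t) <= F t.
Proof.
move=> cF tt0 t01 t1T; have d0 : 0 < t1 - t0 by lra.
have d1 : 0 < t1 - t by lra.
pose s := (t1 - t0) / (t1 - t).
have sE : s * (t1 - t) = t1 - t0 by rewrite /s divfK// gt_eqF.
have s0 : 0 < s by rewrite divr_gt0.
have s1 : s <= 1 by rewrite ler_pdivrMr//; lra.
have := cF t t1 s ltac:(lra) t1T ltac:(lra).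
have -> : s * t + (1 - s) * t1 = t0 by lra.
move=> h; rewrite -lerBrDl -(ler_pM2l s0).
have -> : s * ((F t0 - F t1) / (t1 - t0) * (t0 - t)) = (F t0 - F t1) * (1 - s).
  have -> : s = (t1 - t0) / (t1 - t) by [].
  by field; lra.
lra.
Qed.

Lemma convex_below_max T F t a b : convex_below T F -> a <= t <= b -> b < T ->
  F t <= Num.max (F a) (F b).
Proof.
move=> cF /andP[at_ tb] bT; have [ab|ab] := eqVneq a b.
  have -> : t = a by lra.
  by rewrite le_max lexx.
have d0 : 0 < b - a by rewrite subr_gt0 lt_def eq_sym ab; lra.
pose s := (b - t) / (b - a).
have sE : s * (b - a) = b - t by rewrite /s divfK// gt_eqF.
have s0 : 0 <= s by rewrite divr_ge0//; lra.
have s1 : s <= 1 by rewrite ler_pdivrMr//; lra.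
have := cF a b s ltac:(lra) bT ltac:(lra).
have -> : s * a + (1 - s) * b = t by lra.
move=> h; apply: (le_trans h).
have h1 : F a <= Num.max (F a) (F b) by rewrite le_max lexx.
have h2 : F b <= Num.max (F a) (F b) by rewrite le_max lexx orbT.
nra.
Qed.

Lemma convex_belowD T F G : convex_below T F -> convex_below T G ->
  convex_below T (fun t => F t + G t).
Proof.
by move=> cF cG a b s aT bT s01; have := cF a b s aT bT s01; have := cG a b s aT bT s01; lra.
Qed.

(** A separating slope must be at least every slope from [G] at [s] to [- F] at a later [t], and at
    most every slope from [- F] to a later point of [G]. The supremum of the former works, since
    [ub] puts all of them below all of the latter. *)
Lemma sandwich T F G : convex_below T F -> convex_below T G ->
  (forall t, t < T -> 0 <= F t + G t) ->
  exists a b, forall t, t < T -> - F t <= a * t + b <= G t.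
Proof.
move=> cF cG FG.
pose S := [set x | exists s t, [/\ s < t, t < T & x = (- F t - G s) / (t - s)]].
have ub t' s' : t' < s' -> s' < T -> forall x, S x -> x <= (G s' + F t') / (s' - t').
  move=> ts' sT' x [s [t [st tT ->]]].
  have p1 : 0 < t - s by lra.
  have p2 : 0 < s' - t' by lra.
  have p3 : 0 < (t - s) + (s' - t') by lra.
  rewrite ler_pdivrMr// mulrAC ler_pdivlMr//.
  (* With this weight the combinations of [t, t'] and of [s, s'] are the same point; convexity of
     both functions and [0 <= F + G] there compare the two slopes. *)
  pose l := (s' - t') / ((t - s) + (s' - t')).
  have lE : l * ((t - s) + (s' - t')) = s' - t' by rewrite /l divfK// gt_eqF.
  have l0 : 0 <= l by rewrite divr_ge0// ltW.
  have l1 : l <= 1 by rewrite ler_pdivrMr//; lra.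
  have h1 := cF t t' l tT ltac:(lra) ltac:(lra).
  have h2 := cG s s' l ltac:(lra) sT' ltac:(lra).
  have e : l * t + (1 - l) * t' = l * s + (1 - l) * s' by lra.
  have wT : l * s + (1 - l) * s' < T.
    have [hh|hh] := leP s s'.
      have : 0 <= l * (s' - s) by rewrite mulr_ge0// subr_ge0.
      lra.
    have : 0 <= (1 - l) * (s - s') by rewrite mulr_ge0//; lra.
    lra.
  have := FG _ wT; rewrite e in h1 => h3.
  have h4 : 0 <= l * F t + (1 - l) * F t' + (l * G s + (1 - l) * G s') by lra.
  have : 0 <= ((t - s) + (s' - t')) * (l * F t + (1 - l) * F t' + (l * G s + (1 - l) * G s')).
    by rewrite mulr_ge0// ltW.
  have -> : ((t - s) + (s' - t')) * (l * F t + (1 - l) * F t' + (l * G s + (1 - l) * G s')) =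
    (s' - t') * (F t + G s) + (t - s) * (F t' + G s').
    have e1 : 1 - l = (t - s) / ((t - s) + (s' - t')) by rewrite /l; field; lra.
    by rewrite e1 /l; field; lra.
  lra.
have S0 : S !=set0.
  by exists ((- F (T - 1) - G (T - 2)) / ((T - 1) - (T - 2))), (T - 2), (T - 1); split => //; lra.
have hS : has_sup S.
  by split => //; eexists => x; apply: (ub (T - 2) (T - 1)); lra.
pose a := sup S.
have h1 s t : s < t -> t < T -> - F t - a * t <= G s - a * s.
  move=> st tT; have : (- F t - G s) / (t - s) <= a.
    by apply: sup_upper_bound => //; exists s, t.
  by rewrite ler_pdivrMr; lra.
have h2 s t : t < s -> s < T -> - F t - a * t <= G s - a * s.
  move=> ts sT; have : a <= (G s + F t) / (s - t).
    by apply: ge_sup => // x; exact: ub.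
  by rewrite ler_pdivlMr; lra.
have h3 s t : s < T -> t < T -> - F t - a * t <= G s - a * s.
  move=> sT tT; have [st|st|st] := ltgtP s t; [exact: h1|exact: h2|].
  by rewrite st; have := FG _ tT; lra.
pose S' := [set x | exists2 t, t < T & x = - F t - a * t].
have S'0 : S' !=set0 by eexists; exists (T - 1) => //; lra.
have ub' s : s < T -> forall x, S' x -> x <= G s - a * s.
  by move=> sT x [t tT ->]; exact: h3.
exists a, (sup S') => t tT; apply/andP; split.
  have : - F t - a * t <= sup S'.
    apply: sup_upper_bound; last by exists t.
    by split => //; exists (G t - a * t); exact: ub'.
  lra.
have : sup S' <= G t - a * t by apply: ge_sup => //; exact: ub'.
lra.
Qed.

Lemma bernoulli_ge k (n : nat) : 0 <= k -> 1 + n%:R * k <= (1 + k) ^+ n :> R.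
Proof.
move=> k0; elim: n => [|n IH]; first by rewrite expr0 mul0r addr0.
rewrite exprS -natr1; have : 0 <= n%:R :> R by rewrite ler0n.
nra.
Qed.

(** From a positive [E n], going [2 j] steps and squaring Bernoulli's inequality gives at least
    [(j k)^2 E n], which outgrows any linear bound. *)
Lemma geometric_not_linear (E : nat -> R) k A : 0 < k ->
  (forall n, (1 + k) * E n <= E n.+1) -> (forall n, E n <= A * n.+1%:R) ->
  forall n, E n <= 0.
Proof.
move=> k0 hE hA n; rewrite leNgt; apply/negP => En.
have h j : (1 + k) ^+ j * E n <= E (n + j)%N.
  elim: j => [|j IH]; first by rewrite expr0 mul1r addn0.
  rewrite addnS exprS -mulrA; apply: le_trans (hE _).
  by rewrite ler_pM2l//; lra.
have n1 : 0 < n.+1%:R :> R by rewrite ltr0n.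
have A0 : 0 < A by have := hA n; nra.
pose B := k ^+ 2 * E n.
have B0 : 0 < B by rewrite mulr_gt0// exprn_gt0.
have hj j : B * j%:R ^+ 2 <= A * (n.+1%:R + 2 * j%:R).
  have := h (2 * j)%N; have := hA (n + 2 * j)%N.
  rewrite -addSn natrD natrM => h1 h2; apply: le_trans h1; apply: le_trans h2.
  rewrite /B mulrAC ler_pM2r// mulnC exprM -exprMn.
  have := @bernoulli_ge k j (ltW k0); have : 0 <= j%:R :> R by rewrite ler0n.
  move=> j0 hb; rewrite ler_sqr ?nnegrE; [lra|nra|].
  by rewrite exprn_ge0//; lra.
pose j := (Num.truncn (A * (n.+1%:R + 3) / B)).+1.
have jj : A * (n.+1%:R + 3) / B < j%:R by rewrite truncnS_gt.
rewrite ltr_pdivrMr// in jj.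
have j1 : 1 <= j%:R :> R by rewrite ler1n.
have n0 : 0 <= n.+1%:R :> R by rewrite ler0n.
have := hj j.
have : A * (n.+1%:R + 3) * j%:R < B * j%:R ^+ 2.
  by rewrite expr2 mulrA ltr_pM2r; [lra|lra].
have : A * (n.+1%:R + 2 * j%:R) <= A * ((n.+1%:R + 3) * j%:R).
  rewrite ler_pM2l//; nra.
lra.
Qed.

(** With [k = 1 / C] the recurrence reads [D n.+2 >= (2 + 2 k) D n.+1 - D n - 2 A k q^n]. Since
    [m + 1 / m <= 2 + 2 k] for [m = 1 / (1 + k)], the quantity [E n = D n.+1 - m D n - 2 A q^n]
    gains a factor [1 + k] at each step. At most linear growth then forces [E <= 0], a contraction
    for [D]. *)
Lemma decay_seq (D : nat -> R) C A A' q : 1 <= C -> 0 <= A -> 0 < q < 1 ->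
  (forall k, 0 <= D k) -> (forall k, D k <= A' * k.+1%:R) ->
  (forall k, D k.+1 <= C * ((D k + D k.+2) / 2 - D k.+1) + A * q ^+ k) ->
  exists2 q', 0 < q' < 1 & exists B, forall k, D k <= B * q' ^+ k.
Proof.
move=> C1 A0 /andP[q0 q1] D0 DA hD.
pose k := C^-1; have k0 : 0 < k by rewrite invr_gt0; lra.
have k1 : k <= 1 by rewrite invf_le1//; lra.
have kC : k * C = 1 by rewrite mulVf// gt_eqF//; lra.
pose m := (1 + k)^-1; have mE : m * (1 + k) = 1 by rewrite mulVf// gt_eqF//; lra.
have m0 : 0 < m by rewrite invr_gt0; lra.
have m1 : m < 1 by rewrite invf_lt1//; lra.
have step n : (2 + 2 * k) * D n.+1 - D n - 2 * A * k * q ^+ n <= D n.+2.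
  have := hD n => h.
  have : k * D n.+1 <= k * (C * ((D n + D n.+2) / 2 - D n.+1) + A * q ^+ n) by rewrite ler_pM2l.
  by rewrite mulrDr mulrA kC mul1r; lra.
pose E n := D n.+1 - m * D n - 2 * A * q ^+ n.
have hE n : (1 + k) * E n <= E n.+1.
  have qn : 0 < q ^+ n by rewrite exprn_gt0.
  have := step n; rewrite /E exprS => h.
  have hm : m + (1 + k) <= 2 + 2 * k.
    rewrite -(ler_pM2r (_ : 0 < 1 + k)); last lra.
    by rewrite mulrDl mE; nra.
  have e1 : (1 + k) * (m * D n) = D n by rewrite mulrA [_ * m]mulrC mE mul1r.
  have h2 : (m + (1 + k)) * D n.+1 <= (2 + 2 * k) * D n.+1 by rewrite ler_wpM2r.
  have h3 : A * (q * q ^+ n) <= A * q ^+ n by rewrite ler_wpM2l// ler_piMl// ltW.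
  have e2 : (1 + k) * (D n.+1 - m * D n - 2 * A * q ^+ n) =
    (1 + k) * D n.+1 - D n - 2 * A * q ^+ n - 2 * A * k * q ^+ n.
    by rewrite -[in RHS]e1; ring.
  rewrite e2; lra.
have E0 n : E n <= 0.
  apply: (@geometric_not_linear E k (2 * A') k0 hE) => {}n.
  have := DA n.+1; have := D0 n; rewrite /E.
  have qn : 0 <= A * q ^+ n by rewrite mulr_ge0// exprn_ge0// ltW.
  have mD : 0 <= m * D n by rewrite mulr_ge0// ltW.
  have A'0 : 0 <= A' by have := DA 0%N; have := D0 0%N; rewrite mulr1; lra.
  have n1 : 1 <= n.+1%:R :> R by rewrite ler1n.
  have n2 : n.+2%:R <= 2 * n.+1%:R :> R by rewrite -[n.+2%:R]natr1; lra.
  move=> h2 h3; have : A' * n.+2%:R <= A' * (2 * n.+1%:R) by rewrite ler_wpM2l.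
  lra.
pose p := Num.max m q; pose q' := (1 + p) / 2.
have mp : m <= p by rewrite le_max lexx.
have qp : q <= p by rewrite le_max lexx orbT.
have p1 : p < 1 by rewrite gt_max m1.
exists q'; first by rewrite /q'; lra.
have qm : 0 < q' - m by rewrite /q'; lra.
(* The second entry makes the source term at most [B (q' - m) q'^n], just what completes [m B q'^n]
   to [B q'^(n + 1)]. *)
exists (Num.max (D 0%N) (2 * A / (q' - m))); set B := Num.max _ _.
have B1 : D 0%N <= B by rewrite le_max lexx.
have B2 : 2 * A <= B * (q' - m) by rewrite -ler_pdivrMr// le_max lexx orbT.
elim=> [|n IH]; first by rewrite expr0 mulr1.
have := E0 n; rewrite /E exprS => h.
have hq : q ^+ n <= q' ^+ n.
  by rewrite lerXn2r ?nnegrE//; [exact: ltW|rewrite /q'; lra|rewrite /q'; lra].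
have qn : 0 <= q' ^+ n by rewrite exprn_ge0// /q'; lra.
have h1 : m * D n <= m * (B * q' ^+ n) by rewrite ler_pM2l.
have h2 : 2 * A * q ^+ n <= 2 * A * q' ^+ n by rewrite ler_wpM2l//; lra.
have h3 : 2 * A * q' ^+ n <= B * (q' - m) * q' ^+ n by rewrite ler_wpM2r.
lra.
Qed.

(** Sampling at [T - 1 - k] reduces the claim to [decay_seq]; between two samples a convex function
    stays below the larger one. *)
Lemma decay_exp D T C A A' d : 1 <= C -> 0 <= A -> 0 < d ->
  convex_below T D -> (forall t, t < T -> 0 <= D t) ->
  (forall t, t < T -> D t <= A' * (1 + (T - t))) ->
  (forall t, t < T - 1 ->
     D t <= C * ((D (t - 1) + D (t + 1)) / 2 - D t) + A * expR (d * t)) ->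
  exists2 g, 0 < g & exists B, forall t, t < T - 1 -> D t <= B * expR (g * t).
Proof.
move=> C1 A0 d0 cD D0 DA hD.
pose X k := D (T - 1 - k%:R).
have k0 (k : nat) : 0 <= k%:R :> R by rewrite ler0n.
have XT k : T - 1 - k%:R < T by have := k0 k; lra.
have A'0 : 0 <= A'.
  by have := DA (T - 1) ltac:(lra); have := D0 (T - 1) ltac:(lra); lra.
have q01 : 0 < expR (- d) < 1 by rewrite expR_gt0 expR_lt1; lra.
have [||||q' /andP[q'0 q'1] [B hB]] := @decay_seq X C
   (A * expR (d * (T - 1))) (2 * A') _ C1 _ q01.
- by rewrite mulr_ge0// expR_ge0.
- by move=> k; exact: D0.
- move=> k; apply: (le_trans (DA _ (XT k))).
  have -> : A' * (1 + (T - (T - 1 - k%:R))) = A' * (2 + k%:R) by ring.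
  rewrite [2 * A']mulrC -mulrA ler_wpM2l// -natr1.
  by have := k0 k; lra.
- move=> k; have kk : k.+1%:R = k%:R + 1 :> R by rewrite -natr1.
  have := k0 k => {}k0; have := hD (T - 1 - k.+1%:R) ltac:(lra).
  have -> : T - 1 - k.+1%:R - 1 = T - 1 - k.+2%:R by rewrite -[k.+2%:R]natr1; ring.
  have -> : T - 1 - k.+1%:R + 1 = T - 1 - k%:R by rewrite kk; ring.
  rewrite -/(X k) -/(X k.+1) -/(X k.+2) [X k + _]addrC => /le_trans; apply.
  rewrite lerD2l -mulrA ler_wpM2l// -expRM_natl -expRD ler_expR kk; nra.
have B0 : 0 <= B by have := hB 0%N; rewrite expr0 mulr1; apply: le_trans; exact: D0.
pose g := - ln q'.
have g0 : 0 < g by rewrite oppr_gt0 ln_lt0// q'0.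
(* [q' = exp(- g)], and the sample index [k] exceeds [T - 2 - t]; the constant factor makes up for
   that shift. *)
exists g => //; exists (B * expR (- g * (T - 2))) => t tT.
pose k := Num.truncn (T - 1 - t).
have /andP[k1 k2] : k%:R <= T - 1 - t < k.+1%:R by apply: truncn_itv; lra.
have kk : k.+1%:R = k%:R + 1 :> R by rewrite -natr1.
have : D t <= Num.max (X k.+1) (X k).
  by apply: (convex_below_max cD); rewrite ?XT//; lra.
have hk : X k.+1 <= B * q' ^+ k.
  by apply: (le_trans (hB _)); rewrite ler_wpM2l// exprS ler_piMl ?exprn_ge0// ltW.
move=> /le_trans; apply; rewrite ge_max; apply/andP.
suff S : B * q' ^+ k <= B * expR (- g * (T - 2)) * expR (g * t).
  by split; [exact: le_trans hk S|exact: le_trans (hB k) S].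
rewrite -mulrA ler_wpM2l// -expRD -[q']lnK ?posrE// -expRM_natl ler_expR.
have -> : ln q' = - g by rewrite opprK.
nra.
Qed.

End convexity.

(** * Asymptotics at the singularity *)

Section growth.
Context {R : realType}.
Implicit Types (x y z : R * R) (t a b c d M T : R) (u v L : R * R -> R).

Lemma convex_belowS T T' (F : R -> R) : T' <= T -> convex_below T F ->
  convex_below T' F.
Proof. by move=> TT cF a b s aT bT; apply: cF; lra. Qed.

Lemma lnorm_lt z T : 0 < enorm z -> (lnorm z < T) = (enorm z < expR T).
Proof. by move=> z0; rewrite -(expR_lnorm z0) ltr_expR. Qed.

Lemma pdisc_circle t T z : t < T -> enorm z = expR t -> pdisc (expR T) z.
Proof. by move=> tT zt; rewrite /pdisc/= zt expR_gt0 ltr_expR. Qed.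

Lemma expR1_ge2 : 2 <= expR 1 :> R.
Proof. by have := expR_ge1Dx (1 : R); lra. Qed.

(** As [2 <= e], the Harnack annulus lies in logarithmic distance less than [1]; hence the unit
    steps in the inequality for the gap. *)
Lemma annulus_lnorm t z : annulus (expR t / 2) (2 * expR t) z ->
  0 < enorm z /\ t - 1 < lnorm z < t + 1.
Proof.
move=> /andP[h1 h2]; have e0 := expR_gt0 t; have e2 := expR1_ge2.
have z0 : 0 < enorm z by lra.
split => //; rewrite lnorm_lt// ltNge -(ler_expR _ (t - 1)) (expR_lnorm z0) -ltNge.
rewrite expRD expRN expRD; apply/andP; split; last nra.
rewrite ltr_pdivrMr ?expR_gt0//; nra.
Qed.

Lemma annulus_inv_sqr t z : annulus (expR t / 2) (2 * expR t) z ->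
  (enorm z ^+ 2)^-1 <= 4 / expR t ^+ 2.
Proof.
move=> /andP[h1 h2]; have e0 := expR_gt0 t.
have -> : 4 / expR t ^+ 2 = ((expR t / 2) ^+ 2)^-1 by field; rewrite gt_eqF.
rewrite lef_pV2 ?posrE ?exprn_gt0//; [nra|lra|lra].
Qed.

Section asymptotics.
Variables (u L : R * R -> R) (M : R).
Hypothesis M0 : 0 < M.
Hypothesis uL : has_laplacian (pdisc 1) u L.
Hypothesis Lb : forall z, pdisc 1 z -> - (M * expR (u z)) <= L z <= 0.
Hypothesis decay : forall e, 0 < e -> exists2 d, 0 < d < 1 &
  forall x, 0 < enorm x < d -> enorm x ^+ 2 * expR (u x) <= e.

Lemma sqr_enorm_exp z s : 0 < enorm z ->
  (enorm z ^+ 2 * expR (u z) <= expR s) = (u z + 2 * lnorm z <= s).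
Proof.
move=> z0; rewrite -(expR_lnorm z0) -expRM_natl -expRD ler_expR.
by rewrite addrC.
Qed.

Lemma log_decay s : exists2 T, T < 0 &
  forall z, pdisc (expR T) z -> u z + 2 * lnorm z <= s.
Proof.
have [d /andP[d0 d1] hd] := decay (expR_gt0 s).
exists (ln d); first by rewrite ln_lt0// d0.
move=> z /andP[z0]; rewrite lnK ?posrE// => zd.
by rewrite -sqr_enorm_exp//; apply: hd; rewrite z0.
Qed.

Lemma pdiscS a b : a <= b -> pdisc a `<=` (pdisc b : set (R * R)).
Proof. by move=> ab z; rewrite /pdisc/=; lra. Qed.

Lemma pdisc_expR T : T < 0 -> pdisc (expR T) `<=` (pdisc 1 : set (R * R)).
Proof. by move=> T0; apply: pdiscS; rewrite -expR0 ler_expR ltW. Qed.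

Lemma enorm_gt0_pdisc r z : pdisc r z -> 0 < enorm z.
Proof. by move=> /andP[]. Qed.

Lemma has_laplacian_p T : T < 0 ->
  has_laplacian (pdisc (expR T)) (fun z => - u z + -2 * lnorm z) (fun z => - L z).
Proof.
move=> T0; have := has_laplacianD (has_laplacianN (has_laplacianS (pdisc_expR T0) uL))
  (has_laplacianZ (-2) (has_laplacian_lnorm (@enorm_gt0_pdisc (expR T)))).
by apply: has_laplacian_eq => z _; ring.
Qed.

Lemma linear_upper_bound : exists K T d, [/\ T < 0, 0 < d <= 1 / 2 &
  (forall z, pdisc (expR T) z -> u z + 2 * lnorm z <= K + d * lnorm z)] /\
  exists2 C, 1 <= C & forall t x y, t < T -> enorm x = expR t ->
    enorm y = expR t -> - u x - 2 * t <= C * (- u y - 2 * t + 4 * M).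
Proof.
have [C0 C1 harnack] := @harnack_circle R.
have [T1 T10 h1] := log_decay 0.
have hp t x y : t < T1 - 1 -> enorm x = expR t -> enorm y = expR t ->
    - u x - 2 * t <= C0 * (- u y - 2 * t + 4 * M).
  move=> tT xt yt; have e0 := expR_gt0 t.
  have sub z : annulus (expR t / 2) (2 * expR t) z -> pdisc (expR T1) z.
    move=> /annulus_lnorm[z0 zt]; rewrite /pdisc/= z0 -lnorm_lt//; lra.
  have c0 : 0 <= 4 * M / expR t ^+ 2.
    by apply: divr_ge0; [rewrite mulr_ge0// ltW|rewrite exprn_ge0// ltW].
  have := harnack (expR t) (4 * M / expR t ^+ 2) _ _ x y e0 c0 xt yt
    (has_laplacianS sub (has_laplacian_p T10)).
  rewrite (lnorm_expR xt) (lnorm_expR yt).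
  have -> : 4 * M / expR t ^+ 2 * expR t ^+ 2 = 4 * M by rewrite divfK// gt_eqF// exprn_gt0.
  rewrite !mulNr; apply => z Az; have Uz := sub z Az.
  have z0 := enorm_gt0_pdisc Uz; have uz := h1 z Uz.
  have z2 : 0 < enorm z ^+ 2 by rewrite exprn_gt0.
  split; first lra.
  have /andP[l1 l2] := Lb (pdisc_expR T10 Uz).
  rewrite normrN ler0_norm//.
  have E : enorm z ^+ 2 * expR (u z) <= 1 by rewrite -expR0 sqr_enorm_exp.
  have : expR (u z) <= (enorm z ^+ 2)^-1 by rewrite -div1r ler_pdivlMr// mulrC.
  have := annulus_inv_sqr Az => i1 i2.
  have : M * expR (u z) <= M * (4 / expR t ^+ 2).
    by rewrite ler_pM2l//; exact: le_trans i2 i1.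
  have -> : M * (4 / expR t ^+ 2) = 4 * M / expR t ^+ 2 by ring.
  lra.
have u1L := has_laplacianN (has_laplacianS (pdisc_expR T10) uL).
have [F1 hF1] := circle_max_exists (has_laplacian_continuous u1L).
have cF1 : convex_below T1 F1.
  apply: (circle_max_convex u1L _ hF1) => z /(pdisc_expR T10)/Lb; lra.
pose t1 := T1 - 1; pose B := F1 t1 - 2 * t1.
have [T2 T20 h2] := log_decay (- B - 1).
pose t0 := Num.min (T2 - 1) (t1 - 1).
have t01 : t0 <= t1 - 1 by rewrite ge_min lexx orbT.
have t02 : t0 <= T2 - 1 by rewrite ge_min lexx.
have Ft0 : B + 1 <= F1 t0 - 2 * t0.
  have [[z zt uz] _] := hF1 t0 ltac:(rewrite /t1 in t01; lra).
  have := h2 z (pdisc_circle _ zt); rewrite (lnorm_expR zt) -uz => /(_ ltac:(lra)).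
  lra.
(* Minus the slope of the chord of [F1 t - 2 t] over [[t0, t1]]; [t0] is deep enough for that chord
   to drop by at least [1]. *)
pose s := (F1 t0 - F1 t1) / (t1 - t0) + 2.
have tt : 0 < t1 - t0 by lra.
have s0 : 0 < s.
  have -> : s = (F1 t0 - 2 * t0 - B) / (t1 - t0) by rewrite /s /B; field; lra.
  by rewrite divr_gt0//; lra.
have Fl t : t < t0 -> B + s * (t0 - t) <= F1 t - 2 * t.
  move=> tt0; have := convex_below_line cF1 (ltW tt0) (_ : t0 < t1) _.
  by rewrite /s => /(_ ltac:(lra) ltac:(rewrite /t1; lra)); lra.
have C00 : 0 < C0 by lra.
(* The cap [1 / 2] is inherited by the final exponent, as the Hoelder estimate requires. *)
pose d := Num.min (s / C0) (1 / 2).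
have d1 : d <= 1 / 2 by rewrite ge_min lexx orbT.
have ds : d <= s / C0 by rewrite ge_min lexx.
have d0 : 0 < d by rewrite lt_min divr_gt0//; lra.
exists (4 * M - (B + s * t0) / C0), t0, d; split; last first.
  exists C0 => // t x y tt0; apply: hp; rewrite /t1 in t01; lra.
split; [rewrite /t1 in t01; lra|lra|].
move=> y /andP[y0 yt]; pose t := lnorm y.
have yE : enorm y = expR t by rewrite expR_lnorm.
have tt0 : t < t0 by rewrite lnorm_lt.
have tT1 : t < T1 by rewrite /t1 in t01; lra.
have [[x xt ux] _] := hF1 t tT1.
have := hp t x y ltac:(rewrite /t1 in t01; lra) xt yE; rewrite ux => hh.
have h3 : B + s * t0 - s * t <= C0 * (- u y - 2 * t + 4 * M) by have := Fl t tt0; lra.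
have h4 : (B + s * t0 - s * t) / C0 <= - u y - 2 * t + 4 * M.
  by rewrite ler_pdivrMr// [leRHS]mulrC.
have t0' : t <= 0 by rewrite /t1 in t01; lra.
have h5 : s / C0 * t <= d * t by rewrite ler_wnM2r.
have -> : lnorm y = t by [].
have : (B + s * t0 - s * t) / C0 = (B + s * t0) / C0 - s / C0 * t by field; lra.
lra.
Qed.

Theorem log_asymptotics : exists a b g C T,
  [/\ -2 < a, 0 < g <= 1 / 2, 0 <= C & T < 0] /\
  forall z, pdisc (expR T) z ->
    `|u z - (a * lnorm z + b)| <= C * expR (g * lnorm z) /\
    `|L z| <= C * expR (g * lnorm z) / enorm z ^+ 2.
Proof.
have [K [T2 [d [[T20 /andP[d0 d1] ub] [C0 C01 hp]]]]] := linear_upper_bound.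
have [C1 C11 harnack] := @harnack_circle R.
(* Then [B |x|^d] has Laplacian [M exp(K) |x|^(d - 2)], exactly the bound on [- L] that [ub]
   gives. *)
pose B := M * expR K / d ^+ 2.
have d2 : 0 < d ^+ 2 by rewrite exprn_gt0.
have BE : B * d ^+ 2 = M * expR K by rewrite /B divfK// gt_eqF.
have B0 : 0 < B by rewrite divr_gt0// mulr_gt0// expR_gt0.
have Lz z : pdisc (expR T2) z ->
    - (B * (d ^+ 2 * expR (d * lnorm z) / enorm z ^+ 2)) <= L z <= 0.
  move=> Uz; have z0 := enorm_gt0_pdisc Uz.
  have z2 : 0 < enorm z ^+ 2 by rewrite exprn_gt0.
  have /andP[l1 ->] := Lb (pdisc_expR T20 Uz); rewrite andbT.
  apply: le_trans l1; rewrite lerN2.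
  have -> : B * (d ^+ 2 * expR (d * lnorm z) / enorm z ^+ 2) =
     M * (expR K * expR (d * lnorm z) / enorm z ^+ 2).
    transitivity (B * d ^+ 2 * (expR (d * lnorm z) / enorm z ^+ 2)); first by ring.
    by rewrite BE; ring.
  rewrite ler_pM2l// ler_pdivlMr// -expRD mulrC sqr_enorm_exp//; exact: ub.
pose v2 z := u z + B * expR (d * lnorm z).
pose L2 z := L z + B * (d ^+ 2 * expR (d * lnorm z) / enorm z ^+ 2).
have v2L : has_laplacian (pdisc (expR T2)) v2 L2.
  apply: has_laplacianD; first exact: has_laplacianS (pdisc_expR T20) uL.
  apply: has_laplacianZ; apply: has_laplacian_exp_lnorm; exact: enorm_gt0_pdisc.
have u1L := has_laplacianN (has_laplacianS (pdisc_expR T20) uL).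
have [F1 hF1] := circle_max_exists (has_laplacian_continuous u1L).
have [F2 hF2] := circle_max_exists (has_laplacian_continuous v2L).
have cF1 : convex_below T2 F1.
  by apply: (circle_max_convex u1L _ hF1) => z /Lz; lra.
have cF2 : convex_below T2 F2.
  by apply: (circle_max_convex v2L _ hF2) => z /Lz; rewrite /L2; lra.
have ed t : t < 0 -> 0 < expR (d * t) <= 1.
  by move=> t0; rewrite expR_gt0 -expR0 ler_expR; nra.
have F12 t : t < T2 -> 0 <= F1 t + F2 t.
  move=> tT; have [[x xt ux] _] := hF1 t tT; have := (hF2 t tT).2 x xt.
  rewrite -ux /v2 (lnorm_expR xt).
  have : 0 < B * expR (d * t) by rewrite mulr_gt0// expR_gt0.
  lra.
pose T3 := T2 - 2.
pose k := (F2 T3 - F2 (T2 - 1)) / (T2 - 1 - T3).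
have F2l t : t < T3 -> F2 T3 + k * (T3 - t) <= F2 t.
  move=> tT; apply: (convex_below_line cF2 (ltW tT)); rewrite /T3; lra.
have F2u t : t < T2 -> F2 t <= - 2 * t + K + d * t + B.
  move=> tT; have [[y yt <-] _] := hF2 t tT; rewrite /v2 (lnorm_expR yt).
  have := ub y (pdisc_circle tT yt); rewrite (lnorm_expR yt).
  have : B * expR (d * t) <= B by rewrite ler_piMr ?(ltW B0)//; have := ed t ltac:(lra); lra.
  lra.
pose D t := F1 t + F2 t.
have cD : convex_below T3 D.
  by apply: convex_belowS (convex_belowD cF1 cF2); rewrite /T3; lra.
have D0 t : t < T3 -> 0 <= D t by rewrite /T3 => tT; apply: F12; lra.
(* Convexity bounds [F2] below linearly; Harnack at the point where [v2] is largest turns this into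
   a linear upper bound for [F1]. [A'] collects the constants. *)
pose A' := C0 * (`|F2 T3| + `|k| + B + 2 + 4 * M + 2 * `|T3|) + B + `|K|.
have Dlin t : t < T3 -> D t <= A' * (1 + (T3 - t)).
  move=> tT; have tT2 : t < T2 by rewrite /T3 in tT; lra.
  have [[x xt ux] _] := hF1 t tT2; have [[y yt uy] _] := hF2 t tT2.
  have := hp t x y tT2 xt yt; rewrite ux.
  have uyE : u y = F2 t - B * expR (d * t) by rewrite -uy /v2 (lnorm_expR yt); ring.
  rewrite uyE => h1.
  have h2 : B * expR (d * t) <= B.
    by rewrite ler_piMr ?(ltW B0)//; have := ed t ltac:(lra); lra.
  have h3 := F2l t tT.
  have h4 : - F2 t <= `|F2 T3| + `|k| * (T3 - t).
    have : - k * (T3 - t) <= `|k| * (T3 - t).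
      by rewrite ler_wpM2r//; [lra|rewrite -normrN ler_norm].
    have := ler_norm (- F2 T3); rewrite normrN; lra.
  have h5 : - T3 <= `|T3| by rewrite -normrN ler_norm.
  have tp : 0 <= T3 - t by lra.
  have h6 : - (F2 t - B * expR (d * t)) - 2 * t + 4 * M <=
     (`|F2 T3| + `|k| + B + 2 + 4 * M + 2 * `|T3|) * (1 + (T3 - t)).
    have : 0 <= (`|F2 T3| + B + 4 * M + 2 * `|T3|) * (T3 - t).
      apply: mulr_ge0 => //; have := normr_ge0 (F2 T3); have := normr_ge0 T3.
      by have := M0; lra.
    have := normr_ge0 k; lra.
  have h7 : F1 t - 2 * t <= C0 *
     ((`|F2 T3| + `|k| + B + 2 + 4 * M + 2 * `|T3|) * (1 + (T3 - t))).
    by apply: (le_trans h1); rewrite ler_pM2l//; lra.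
  have h8 := F2u t tT2.
  have h9 : K + d * t + B <= (B + `|K|) * (1 + (T3 - t)).
    have : 0 <= (B + `|K|) * (T3 - t) by rewrite mulr_ge0// addr_ge0// ltW.
    have := ler_norm K; nra.
  rewrite /D /A'; lra.
have main t : t < T3 - 1 -> D t <= C1 * ((D (t - 1) + D (t + 1)) / 2 - D t) +
    (C1 * (4 * B * d ^+ 2 * expR d) + B) * expR (d * t).
  move=> tT; have tT2 : t + 1 < T2 by rewrite /T3 in tT; lra.
  have e0 := expR_gt0 t; have edt := expR_gt0 (d * t).
  have sub z : annulus (expR t / 2) (2 * expR t) z -> pdisc (expR T2) z.
    move=> /annulus_lnorm[z0 zt]; rewrite /pdisc/= z0 -lnorm_lt//; lra.
  (* [v] is the chord of [F2] over [[t - 1, t + 1]] minus [v2], nonnegative on the annulus by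
     convexity. Harnack compares its value at [x], where [u] is least on the circle, with that at
     [y], where [v2] is greatest. *)
  pose m := (F2 (t + 1) - F2 (t - 1)) / 2.
  pose v z := -1 * v2 z + (m * lnorm z + (F2 (t - 1) - m * (t - 1))).
  have vL : has_laplacian (annulus (expR t / 2) (2 * expR t)) v (fun z => - L2 z).
    apply: (@has_laplacian_eq _ _ _ (fun z => -1 * L2 z + (m * 0 + 0))).
      by move=> z _; ring.
    apply: has_laplacianD.
      apply: has_laplacianZ; exact: has_laplacianS sub v2L.
    apply: has_laplacianD; last exact: has_laplacian_cst.
    apply: has_laplacianZ; apply: has_laplacian_lnorm => z /sub.
    exact: enorm_gt0_pdisc.
  have [[x xt ux] _] := hF1 t ltac:(lra); have [[y yt uy] _] := hF2 t ltac:(lra).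
  pose c := 4 * B * d ^+ 2 * expR (d * (t + 1)) / expR t ^+ 2.
  have c0 : 0 <= c.
    apply: divr_ge0; last by rewrite exprn_ge0// ltW.
    apply: mulr_ge0; last exact: expR_ge0.
    by apply: mulr_ge0; [lra|exact: ltW].
  have := harnack (expR t) c v _ x y e0 c0 xt yt vL.
  have -> : c * expR t ^+ 2 = 4 * B * d ^+ 2 * expR d * expR (d * t).
    rewrite /c divfK ?gt_eqF ?exprn_gt0// mulrDr mulr1 expRD; ring.
  have -> : v x = (F2 (t - 1) + F2 (t + 1)) / 2 + F1 t - B * expR (d * t).
    by rewrite /v /v2 (lnorm_expR xt) -ux /m; field.
  have -> : v y = (F2 (t - 1) + F2 (t + 1)) / 2 - F2 t.
    by rewrite /v uy (lnorm_expR yt) /m; field.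
  move=> /(_ _)/wrap[].
    move=> z Az; have Uz := sub z Az; have z0 := enorm_gt0_pdisc Uz.
    have [_ zt] := annulus_lnorm Az.
    split.
      have : v2 z <= F2 (lnorm z).
        by apply: (hF2 (lnorm z) _).2; [lra|rewrite expR_lnorm].
      pose s := (t + 1 - lnorm z) / 2.
      have := cF2 (t - 1) (t + 1) s ltac:(lra) tT2 ltac:(rewrite /s; lra).
      have -> : s * (t - 1) + (1 - s) * (t + 1) = lnorm z by rewrite /s; field.
      have -> : s * F2 (t - 1) + (1 - s) * F2 (t + 1) =
         m * lnorm z + (F2 (t - 1) - m * (t - 1)) by rewrite /s /m; field.
      rewrite /v; lra.
    have := Lz z Uz.
    have lb : B * (d ^+ 2 * expR (d * lnorm z) / enorm z ^+ 2) <= c.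
      rewrite /c.
      have -> : 4 * B * d ^+ 2 * expR (d * (t + 1)) / expR t ^+ 2 =
        B * (d ^+ 2 * expR (d * (t + 1)) * (4 / expR t ^+ 2)) by ring.
      rewrite ler_pM2l//; apply: ler_pM.
      - by rewrite mulr_ge0 ?expR_ge0// ltW.
      - by rewrite invr_ge0 exprn_ge0// ltW.
      - rewrite ler_pM2l// ler_expR ler_pM2l//; lra.
      - exact: annulus_inv_sqr.
    by rewrite normrN /L2 ler_norml; lra.
  (* Convexity of [F2] bounds [v x] below by [D t] up to the power term; convexity of [F1] lets the
     second difference of [D] replace that of [F2]. *)
  have h1 := cF1 (t - 1) (t + 1) (1 / 2) ltac:(lra) tT2 ltac:(lra).
  have h2 := cF2 (t - 1) (t + 1) (1 / 2) ltac:(lra) tT2 ltac:(lra).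
  have e : 1 / 2 * (t - 1) + (1 - 1 / 2) * (t + 1) = t by field.
  rewrite e in h1 h2 => h3.
  have h4 : C1 * ((F2 (t - 1) + F2 (t + 1)) / 2 - F2 t) <=
     C1 * ((D (t - 1) + D (t + 1)) / 2 - D t).
    by rewrite ler_pM2l; [rewrite /D; lra|lra].
  rewrite {1}/D; lra.
have A0 : 0 <= C1 * (4 * B * d ^+ 2 * expR d) + B.
  apply: addr_ge0; last exact: ltW.
  apply: mulr_ge0; first lra.
  apply: mulr_ge0; last exact: expR_ge0.
  by apply: mulr_ge0; [lra|exact: ltW].
have [g0 g00 [E hE]] := decay_exp C11 A0 d0 cD D0 Dlin main.
have T3T2 : T3 <= T2 by rewrite /T3; lra.
have [a [b ab]] := sandwich (convex_belowS T3T2 cF1) (convex_belowS T3T2 cF2) D0.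
pose g := Num.min g0 d.
have gg : g <= g0 by rewrite ge_min lexx.
have gd : g <= d by rewrite ge_min lexx orbT.
have g_gt0 : 0 < g by rewrite lt_min g00.
have T30 : T3 - 1 < 0 by lra.
exists a, b, g, (`|E| + B * d ^+ 2), (T3 - 1); split.
  split; [|lra|apply: addr_ge0 => //; apply: mulr_ge0; exact: ltW|exact: T30].
  (* The line satisfies [a t + b <= F2 t <= (d - 2) t + K + B], which at [-oo] forces [a >= d - 2];
     if [a <= -2], the [t] chosen below violates it. *)
  rewrite ltNge; apply/negP => a2.
  pose q := d - (a + 2); have q0 : 0 < q by rewrite /q; lra.
  pose Q := K + B - b.
  pose t := - (`|Q| + 1) / q - `|T3| - 2.
  have Qq : 0 <= (`|Q| + 1) / q by apply: divr_ge0; [rewrite addr_ge0|exact: ltW].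
  have tT3 : t < T3.
    have : - T3 <= `|T3| by rewrite -normrN ler_norm.
    by rewrite /t mulNr; lra.
  have /andP[_ h1] := ab t tT3; have h2 := F2u t ltac:(lra).
  have h3 : - q * t <= Q by rewrite /q /Q; lra.
  have : - q * t = `|Q| + 1 + q * (`|T3| + 2) by rewrite /t; field; lra.
  have : 0 <= q * (`|T3| + 2) by apply: mulr_ge0; [exact: ltW|rewrite addr_ge0].
  have := ler_norm Q; lra.
move=> z /andP[z0 zT]; pose t := lnorm z.
have tT : t < T3 - 1 by rewrite lnorm_lt.
have zt : enorm z = expR t by rewrite expR_lnorm.
have tT2 : t < T2 by lra.
have eg : expR (g0 * t) <= expR (g * t) by rewrite ler_expR ler_wnM2r//; lra.
have egd : expR (d * t) <= expR (g * t) by rewrite ler_expR ler_wnM2r//; lra.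
have Bd : 0 <= B * d ^+ 2 by apply: mulr_ge0; exact: ltW.
split.
  (* Both [u z] and [a t + b] lie between [- F1 t] and [F2 t], so they differ by at most [D t]. *)
  have /andP[a1 a2] := ab t ltac:(lra).
  have h1 := (hF1 t tT2).2 z zt; have := (hF2 t tT2).2 z zt.
  rewrite /v2 -/t => h2.
  have h3 : 0 < B * expR (d * t) by rewrite mulr_gt0// expR_gt0.
  apply: (@le_trans _ _ (D t)); first by rewrite /D ler_norml; lra.
  apply: (le_trans (hE t tT)); apply: (@le_trans _ _ (`|E| * expR (g * t))).
    apply: (@le_trans _ _ (`|E| * expR (g0 * t))).
      by rewrite ler_wpM2r ?expR_ge0// ler_norm.
    by rewrite ler_wpM2l.
  by rewrite ler_wpM2r ?expR_ge0//; lra.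
have /andP[l1 l2] := Lz z (pdisc_circle tT2 zt).
rewrite ler0_norm//; apply: (@le_trans _ _ (B * (d ^+ 2 * expR (d * t) / enorm z ^+ 2))).
  by move: l1; rewrite -/t; lra.
have -> : B * (d ^+ 2 * expR (d * t) / enorm z ^+ 2) =
  B * d ^+ 2 * expR (d * t) / enorm z ^+ 2 by ring.
rewrite ler_pM2r ?invr_gt0 ?exprn_gt0//.
by apply: ler_pM => //; rewrite lerDr.
Qed.

End asymptotics.
End growth.

(** * Hoelder continuity *)

Section hoelder.
Context {R : realType}.
Implicit Types (x y z : R * R) (r h s t a b c d M T : R) (u v L : R * R -> R).
Local Notation mu := (@lebesgue_measure R).
Local Notation mu2 := (mu \x mu)%E.

Lemma keta_lipschitz a s t : 0 < a ->
  `|keta a s - keta a t| <= 4 / a ^+ 2 * `|s - t|.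
Proof.
move=> a0; rewrite /keta -mulrBr normrM gtr0_norm ?divr_gt0//.
have -> : 4 / a ^+ 2 * `|s - t| = 4 / a * (`|s - t| / a) by field; lra.
rewrite ler_pM2l ?divr_gt0//.
have -> : `|s - t| / a = `|s / a - t / a|.
  by rewrite -mulrBl normrM normfV (gtr0_norm a0).
have max1 (p q : R) : Num.max 0 (1 - p) - Num.max 0 (1 - q) <= `|p - q|.
  have n0 := normr_ge0 (p - q); have n1 := ler_norm (q - p); rewrite distrC in n1.
  by case: (leP 0 (1 - p)) => hp; case: (leP 0 (1 - q)) => hq; lra.
have h1 := max1 (s / a) (t / a); have h2 := max1 (t / a) (s / a).
by rewrite distrC in h2; rewrite ler_norml; lra.
Qed.

Lemma sq_integral_norm_le x r u k : 0 <= r -> continuous_on (sq x r) u ->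
  (forall z, sq x r z -> `|u z| <= k) ->
  `|\int[mu2]_(z in sq x r) u z| <= k * (2 * r) ^+ 2.
Proof.
move=> r0 cu uk; rewrite ler_norml -mulNr -!(sq_integral_cst x _ r0).
apply/andP; split; apply: sq_integral_le => //; try exact: continuous_on_cst.
  by move=> z /uk; rewrite ler_norml => /andP[].
by move=> z /uk; rewrite ler_norml => /andP[].
Qed.

(** The mean value inequalities at [x] and [y] use bumps of the same radius [r], which differ little
    when [h] is small against [r]. Their difference enters once against [u] and once through the
    masses; dividing by a mass at least [2] leaves [640 B h / r]. *)
Lemma local_modulus x y r h c B u L : 0 < h -> h <= r -> 0 <= c -> sq x h y ->
  has_laplacian (sq x (2 * r)) u L ->
  (forall z, sq x (2 * r) z -> `|u z| <= B /\ `|L z| <= c) ->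
  u x - u y <= 640 * (B * h / r) + 9 * (c * r ^+ 2).
Proof.
move=> h0 hr c0 xy uL H.
have r0 : 0 < r by lra.
have r20 : 0 < 2 * r by lra.
have r2 : 0 < r ^+ 2 by rewrite exprn_gt0.
have s1 : Num.sqrt (r ^+ 2) = r by rewrite sqrtr_sqr gtr0_norm.
have Qx : sq x (Num.sqrt (r ^+ 2)) `<=` sq x (2 * r).
  by rewrite s1; apply: sq_le; lra.
have Qy : sq y (Num.sqrt (r ^+ 2)) `<=` sq x (2 * r).
  by rewrite s1 => z /(sq_trans xy); apply: sq_le; lra.
have Lc1 z : sq x (2 * r) z -> - c <= L z.
  by move=> /H[_]; rewrite ler_norml; lra.
have Lc2 z : sq x (2 * r) z -> L z <= c.
  by move=> /H[_]; rewrite ler_norml; lra.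
have cu := has_laplacian_continuous uL.
have ck w : continuous_on (sq x (2 * r)) (fun z => keta (r ^+ 2) (N w z)).
  by move=> z _; exact: continuous_keta_N.
have yQ : sq x (2 * r) y by apply: sq_le xy; lra.
have /H[uyB _] := yQ.
have B0 : 0 <= B := le_trans (normr_ge0 _) uyB.
(* The Lipschitz constant [4 / r^4] of the bump in the squared distance, times the bound [10 h r] on
   the change of squared distance; over the area [16 r^2] it integrates to [640 h / r]. *)
pose e := 40 * h / r ^+ 3.
have e0 : 0 <= e by rewrite divr_ge0// ?exprn_ge0; lra.
have ke z : sq x (2 * r) z ->
    `|keta (r ^+ 2) (N x z) - keta (r ^+ 2) (N y z)| <= e.
  move=> [z1 z2]; have [y1 y2] := xy.
  apply: (le_trans (keta_lipschitz _ _ r2)).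
  have -> : e = 4 / (r ^+ 2) ^+ 2 * (10 * h * r) by rewrite /e; field; lra.
  rewrite ler_pM2l; last by rewrite divr_gt0// exprn_gt0.
  have -> : N x z - N y z = (y.1 - x.1) * ((z.1 - x.1) + (z.1 - x.1) - (y.1 - x.1))
     + (y.2 - x.2) * ((z.2 - x.2) + (z.2 - x.2) - (y.2 - x.2)) by rewrite /N; ring.
  apply: (le_trans (ler_normD _ _)); rewrite !normrM.
  have -> : 10 * h * r = h * (5 * r) + h * (5 * r) by ring.
  apply: lerD; apply: ler_pM => //.
    by apply: (le_trans (ler_normB _ _)); have := ler_normD (z.1 - x.1) (z.1 - x.1); lra.
  by apply: (le_trans (ler_normB _ _)); have := ler_normD (z.2 - x.2) (z.2 - x.2); lra.
have := mean_value_le r20 r2 c0 Qx uL Lc1.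
have := mean_value_ge r20 r2 c0 Qy uL Lc2.
have := keta_integral_ge r2 Qx.
have := keta_integral_ge r2 Qy.
have := keta_integral_le x y r2 (ltW r20).
have := @sq_integral_norm_le x (2 * r) _ e (ltW r20) (continuous_onB (ck x) (ck y)) ke.
rewrite sq_integralB//.
have := @sq_integral_norm_le x (2 * r) (fun z => u z * keta (r ^+ 2) (N x z) -
   u z * keta (r ^+ 2) (N y z)) (B * e) (ltW r20).
rewrite sq_integralB; [|exact: continuous_onM|exact: continuous_onM].
set Jx := \int[mu2]_(z in sq x (2 * r)) keta (r ^+ 2) (N x z).
set Jy := \int[mu2]_(z in sq x (2 * r)) keta (r ^+ 2) (N y z).
set Ix := \int[mu2]_(z in sq x (2 * r)) (u z * keta (r ^+ 2) (N x z)).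
set Iy := \int[mu2]_(z in sq x (2 * r)) (u z * keta (r ^+ 2) (N y z)).
clearbody Jx Jy Ix Iy => hI hJ hJy hJy2 hJx hy hx.
have {}hI : `|Ix - Iy| <= B * e * (2 * (2 * r)) ^+ 2.
  apply: hI; first by apply: continuous_onB; exact: continuous_onM.
  move=> z Qz; rewrite -mulrBr normrM; apply: ler_pM => //; last exact: ke.
  by have [] := H z Qz.
have eE : e * (2 * (2 * r)) ^+ 2 = 640 * h / r by rewrite /e; field; lra.
have E16 : 16 * (2 * r) ^+ 2 / r ^+ 2 = 64 by field; lra.
rewrite E16 in hJy; rewrite -mulrA eE in hI; rewrite eE in hJ.
pose f := 640 * h / r; rewrite -/f in hI hJ.
have -> : 640 * (B * h / r) = B * f by rewrite /f; field; lra.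
pose d := c * r ^+ 2; have d0 : 0 <= d by rewrite mulr_ge0// ltW.
have dE : c * (r ^+ 2 / 4) = d / 4 by rewrite /d; field.
rewrite dE in hx hy; rewrite -/d.
have yJ : u y * (Jy - Jx) <= B * f.
  apply: (le_trans (ler_norm _)); rewrite normrM distrC; exact: ler_pM.
have IJ : Ix - Iy <= B * f by apply: le_trans hI; exact: ler_norm.
have h1 : (u x - u y - d / 4) * Jx <= 2 * (B * f) + 16 * d.
  have : d / 4 * Jy <= d / 4 * 64 by rewrite ler_wpM2l//; lra.
  lra.
have [neg|pos] := leP (u x - u y - d / 4) 0.
  have f0 : 0 <= f.
    by apply: divr_ge0; [apply: mulr_ge0; [rewrite ler0n|exact: ltW]|exact: ltW].
  have : 0 <= B * f by exact: mulr_ge0.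
  lra.
have : (u x - u y - d / 4) * 2 <= (u x - u y - d / 4) * Jx by rewrite ler_pM2l.
lra.
Qed.

Lemma exp_lnorm_powR z a : 0 < enorm z -> expR (a * lnorm z) = enorm z `^ a.
Proof. by move=> z0; rewrite lnormE// /powR gt_eqF. Qed.

Lemma powR_le_scale k s a : 1 <= k -> 0 <= s -> 0 <= a <= 1 ->
  (k * s) `^ a <= k * s `^ a.
Proof.
move=> k1 s0 /andP[a0 a1]; rewrite powRM//; last lra.
rewrite ler_wpM2r ?powR_ge0//; apply: (@le_trans _ _ (k `^ 1)); last by rewrite powRr1//; lra.
exact: ler_powR.
Qed.

(** If [h >= |x| / 16], both points are within [17 h] of the origin and the size of [v - b]
    suffices. Otherwise [local_modulus] applies on a square that stays away from the origin at the
    scale of [|x|]. *)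
Theorem hoelder_at_singularity v L b g C r : 0 < g <= 1 / 2 -> 0 <= C -> 0 < r ->
  has_laplacian (pdisc (2 * r)) v L ->
  (forall z, pdisc (2 * r) z -> `|v z - b| <= C * enorm z `^ g /\
     `|L z| <= C * enorm z `^ g / enorm z ^+ 2) ->
  hoelder_on g (disc r) (fun z => if enorm z == 0 then b else v z).
Proof.
move=> /andP[g0 g1] C0 r0 vL H; set phi := fun z => _.
have g01 : 0 <= g <= 1 by lra.
have phib z : disc r z -> `|phi z - b| <= C * enorm z `^ g.
  rewrite /disc/= /phi => zr; have [->|z0] := eqVneq (enorm z) 0.
    by rewrite subrr normr0 mulr_ge0// powR_ge0.
  have zp : 0 < enorm z by rewrite lt_def z0 enorm_ge0.
  by have [] := H z; rewrite /pdisc/= ?zp//=; lra.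
(* Large enough for [640 * 4 C + 9 * 2 C] in the near case and [34 C] in the far one. *)
exists (640 * (5 * C)) => x y Dx Dy; have [xy|xy] := eqVneq (enorm (x - y)) 0.
  have : x = y.
    have := sqr_enorm (x - y); rewrite xy expr0n /= => hh.
    have h1 : x.1 - y.1 = 0 by apply/eqP; rewrite -sqrf_eq0;
      have := sqr_ge0 (x.1 - y.1); have := sqr_ge0 (x.2 - y.2); lra.
    have h2 : x.2 - y.2 = 0 by apply/eqP; rewrite -sqrf_eq0;
      have := sqr_ge0 (x.1 - y.1); have := sqr_ge0 (x.2 - y.2); lra.
    by case: (x) (y) h1 h2 => x1 x2 [y1 y2] /= h1 h2; congr (_, _); lra.
  move=> ->; rewrite subrr normr0; apply: mulr_ge0; last exact: powR_ge0.
  lra.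
pose h := enorm (x - y); have h0 : 0 < h by rewrite lt_def xy enorm_ge0.
rewrite -/h.
suff S x' y' : disc r x' -> disc r y' -> enorm (x' - y') = h ->
    phi x' - phi y' <= 640 * (5 * C) * h `^ g.
  rewrite ler_norml; have := S x y Dx Dy erefl.
  by have := S y x Dy Dx; rewrite enormB => /(_ erefl); lra.
clearbody h; move: x' y' => {Dx Dy xy}x {}y Dx Dy xy; have hg0 := powR_ge0 h g.
have [far|near] := leP (enorm x / 16) h.
  have yh : enorm y <= 17 * h by have := enorm_sub y x; rewrite enormB xy; lra.
  have px := phib x Dx; have py := phib y Dy.
  have xg : enorm x `^ g <= 17 * h `^ g.
    apply: (@le_trans _ _ ((17 * h) `^ g)); last by apply: powR_le_scale; lra.
    by apply: ge0_ler_powR; rewrite ?nnegrE ?enorm_ge0//; lra.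
  have yg : enorm y `^ g <= 17 * h `^ g.
    apply: (@le_trans _ _ ((17 * h) `^ g)); last by apply: powR_le_scale; lra.
    by apply: ge0_ler_powR; rewrite ?nnegrE ?enorm_ge0//; lra.
  have h1 : C * enorm x `^ g <= C * (17 * h `^ g) by rewrite ler_wpM2l.
  have h2 : C * enorm y `^ g <= C * (17 * h `^ g) by rewrite ler_wpM2l.
  have h3 : 0 <= C * h `^ g by rewrite mulr_ge0.
  move: px py; rewrite !ler_norml => /andP[_ px] /andP[py _]; lra.
have [n nE] : exists n, n = enorm x by exists (enorm x).
rewrite -nE in near; have n0 : 0 < n by lra.
have nr : n < r by rewrite nE.
have nh : 0 < n * h by rewrite mulr_gt0.
pose q := Num.sqrt (h / n).
have hn : 0 < h / n by rewrite divr_gt0.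
have q0 : 0 < q by rewrite sqrtr_gt0.
have q2 : q ^+ 2 = h / n by rewrite sqr_sqrtr// ltW.
have hE : h = n * q ^+ 2 by rewrite q2 mulrC divfK// gt_eqF.
have qE : q = (h / n) `^ (2^-1) by rewrite powR12_sqrt// ltW.
clearbody q.
have q14 : q <= 1 / 4.
  have hn16 : h / n < 1 / 16 by rewrite ltr_pdivrMr//; lra.
  rewrite leNgt; apply/negP => qq; nra.
(* Half the geometric mean of [n] and [h]: the terms [B h / s] and [c s^2] of [local_modulus] become
   multiples of [P q] and [P q^2]. *)
pose s := n * q / 2.
have s0 : 0 < s by rewrite divr_gt0// mulr_gt0.
have nq : 0 < n * q by rewrite mulr_gt0.
have nq4 : n * q <= n * (1 / 4) by rewrite ler_pM2l.
have nqq : n * q * q <= n * q * (1 / 4) by rewrite ler_pM2l.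
have sn : s <= n / 8 by rewrite /s; lra.
have hs : h <= s by rewrite hE expr2 mulrA /s; lra.
have sub z : sq x (2 * s) z -> n / 2 <= enorm z <= 2 * n.
  move=> /sq_enorm hz; have h1 := enorm_sub x z; have h2 := enorm_sub z x.
  rewrite enormB -nE in h1; rewrite -nE in h2.
  by move: h1 h2 hz sn; clear=> *; lra.
have sub' : sq x (2 * s) `<=` pdisc (2 * r).
  by move=> z /sub; rewrite /pdisc/=; lra.
have sxy : sq x h y by apply: enorm_sq; rewrite enormB xy.
pose P := n `^ g; have P0 : 0 <= P by exact: powR_ge0.
have Pz z : sq x (2 * s) z -> enorm z `^ g <= 2 * P.
  move=> /sub/andP[_ z2]; apply: (@le_trans _ _ ((2 * n) `^ g)).
    by apply: ge0_ler_powR; rewrite ?nnegrE ?enorm_ge0//; lra.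
  by apply: powR_le_scale; lra.
have n2 : 0 < n ^+ 2 by rewrite exprn_gt0.
have c0 : 0 <= 8 * C * P / n ^+ 2 by rewrite divr_ge0 ?(ltW n2)// !mulr_ge0.
have := @local_modulus x y s h (8 * C * P / n ^+ 2) (2 * C * P) (fun z => v z + - b) L
  h0 hs c0 sxy.
have -> : 2 * C * P * h / s = 4 * C * P * q by rewrite /s hE; field; lra.
have -> : 8 * C * P / n ^+ 2 * s ^+ 2 = 2 * C * P * q ^+ 2 by rewrite /s; field; lra.
have wL : has_laplacian (sq x (2 * s)) (fun z => v z + - b) L.
  apply: (@has_laplacian_eq _ _ _ (fun z => L z + 0)); first by move=> z _; rewrite addr0.
  by apply: has_laplacianD; [exact: has_laplacianS sub' vL|exact: has_laplacian_cst].
have phiE z : sq x (2 * s) z -> phi z = v z.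
  by move=> /sub' /andP[z0 _]; rewrite /phi gt_eqF.
have Qx : sq x (2 * s) x by split; rewrite subrr normr0; lra.
have Qy : sq x (2 * s) y by apply: sq_le sxy; lra.
move=> /(_ wL) mod_.
have {}mod_ : phi x - phi y <= 640 * (4 * C * P * q) + 9 * (2 * C * P * q ^+ 2).
  rewrite (phiE x Qx) (phiE y Qy).
  suff : v x + - b - (v y + - b) <= 640 * (4 * C * P * q) + 9 * (2 * C * P * q ^+ 2) by lra.
  apply: mod_ => z Qz; have [v1 v2] := H z (sub' _ Qz); have Pz' := Pz z Qz.
  split.
    by apply: (le_trans v1); rewrite [2 * C]mulrC -mulrA ler_wpM2l.
  apply: (le_trans v2).
  have -> : 8 * C * P / n ^+ 2 = C * (2 * P) * (4 / n ^+ 2) by ring.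
  have /andP[zn _] := sub z Qz; have zp : 0 < enorm z by lra.
  apply: ler_pM; rewrite ?mulr_ge0 ?invr_ge0 ?exprn_ge0 ?powR_ge0 ?enorm_ge0//.
    by rewrite ler_wpM2l.
  have -> : 4 / n ^+ 2 = ((n / 2) ^+ 2)^-1 by field; lra.
  rewrite lef_pV2 ?posrE ?exprn_gt0//; [|lra].
  rewrite ler_sqr ?nnegrE//; lra.
(* Here [g <= 1 / 2] enters: as [h / n <= 1], its square root is at most its power [g]. *)
have Pq : P * q <= h `^ g.
  have -> : h `^ g = P * (h / n) `^ g.
    rewrite /P -powRM ?(ltW n0) ?(ltW hn)// mulrC divfK// gt_eqF//.
  rewrite ler_wpM2l// qE.
  apply: ger_powR; last lra.
  rewrite hn ler_pdivrMr//; lra.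
have CP : 0 <= C * P by rewrite mulr_ge0.
have h1 : C * P * q ^+ 2 <= C * P * q by rewrite ler_wpM2l//; nra.
have h2 : C * (P * q) <= C * h `^ g by rewrite ler_wpM2l.
have h3 : 0 <= C * h `^ g by rewrite mulr_ge0.
lra.
Qed.

End hoelder.

(** * Choice of the radius and of the Hoelder function *)

Unset Implicit Arguments.

Theorem theorem1p1 (R : realType) (K u : R * R -> R)
  (K_meas : measurable_fun (disc 1) K)
  (K_ess_bdd : exists M : R, (\forall x \ae (@leb2 R), disc 1 x -> `|K x| <= M))
  (K_nonneg : (\forall x \ae (@leb2 R), disc 1 x -> 0 <= K x))
  (u_C2 : C2_on (pdisc 1) u)
  (u_eq : forall x, pdisc 1 x -> - laplacian u x = K x * expR (u x))
  (u_int : (\int[@leb2 R]_(x in pdisc 1) (expR (u x))%:E < +oo)%E) :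
  exists alpha : R, -2 < alpha /\
  exists rho : R, 0 < rho < 1 /\
  exists g : R, 0 < g < 1 /\
  exists phi : R * R -> R, hoelder_on g (disc rho) phi /\
    forall x, pdisc rho x -> u x = alpha * ln (enorm x) + phi x.
Proof.
have [M M0 Lb] := curvature_bounds K_ess_bdd K_nonneg u_C2 u_eq.
have uL := C2_has_laplacian u_C2.
have Lb1 z : pdisc 1 z -> - (M * expR (u z)) <= laplacian u z.
  by move=> /Lb/andP[].
have dec := singular_decay M0 uL Lb1 u_int.
have [a [b [g [C [T [[a2 /andP[g0 g1] C0 T0] H]]]]]] := log_asymptotics M0 uL Lb dec.
have eT0 := expR_gt0 T; have eT1 : expR T < 1 by rewrite expR_lt1.
(* The Hoelder estimate takes its bounds on a disc of twice the radius, so [rho] is half of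
   [expR T]; at the origin [phi] takes the limit value [b]. *)
have r0 : 0 < expR T / 2 by lra.
have r2 : 2 * (expR T / 2) = expR T by field.
have sub := pdisc_expR T0.
have vL : has_laplacian (pdisc (2 * (expR T / 2)))
    (fun z => u z + - a * lnorm z) (laplacian u).
  rewrite r2; apply: (@has_laplacian_eq _ _ _ (fun z => laplacian u z + - a * 0)).
    by move=> z _; rewrite mulr0 addr0.
  apply: has_laplacianD; first exact: has_laplacianS sub uL.
  by apply: has_laplacianZ; apply: has_laplacian_lnorm => z /andP[].
have vb z : pdisc (2 * (expR T / 2)) z ->
    `|u z + - a * lnorm z - b| <= C * enorm z `^ g /\
    `|laplacian u z| <= C * enorm z `^ g / enorm z ^+ 2.
  rewrite r2 => Uz; have /andP[z0 _] := Uz; rewrite -(exp_lnorm_powR g z0).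
  by have := H z Uz; rewrite opprD addrA mulNr.
have gg : 0 < g <= 1 / 2 by rewrite g0.
exists a; split => //; exists (expR T / 2); split; first lra.
exists g; split; first lra.
exists (fun z => if enorm z == 0 then b else u z + - a * lnorm z).
split; first exact: (hoelder_at_singularity gg C0 r0 vL vb).
move=> z /andP[z0 _]; rewrite gt_eqF// lnormE//; ring.
Qed.
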